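(* Let $V$ be a vertex operator algebra, let $p$ be a positive integer, let $\omega_p\in\mathbb{C}$ be a primitive $p$-th root of unity, and let $\nu$ be an automorphism of $V$ with $\nu^p=1_V$. Let $M$ be a vector space (not assumed to be graded) equipped with a linear map $$Y_M(\cdot,x):V\to(\mathrm{End}\,M)[[x^{1/p},x^{-1/p}]],\qquad v\mapsto Y_M(v,x)=\sum_{n\in\frac1p\mathbb{Z}}v_n^\nu x^{-n-1},$$ such that the truncation condition holds: for every $v\in V$ and $w\in M$, $v_n^\nu w=0$ for $n\in\frac1p\mathbb{Z}$ sufficiently large. Fix a generating subset $U\subset V$. Suppose that weak commutativity for $Y_M$ is satisfied for all $u,v\in U$ (and fix $k(u,v)\in\mathbb{N}$ to be the lowest integer that can be taken as exponent both in weak commutativity for $Y_M$ and in weak commutativity for the vertex operator algebra $V$), and that modified weak associativity is satisfied for all $u\in U$ and for all $v\in V$ (with some exponent $k'(u,v)\in\mathbb{N}$ that may be different from $k(u,v)$). Then both weak commutativity for $Y_M$ (with some exponents $k(u,v)\in\mathbb{N}$) and modified weak associativity (with some exponents $k'(u,v)\in\mathbb{N}$) are satisfied for all $u,v\in V$. Further, we may change $k'(u,v)$ (in particular, we may lower it) to $k'(u,v)=k(u,v)$ for $u,v\in V$, and these integers may be taken to satisfy the formula $$k(u_{n_0-m}v,w)=k(w,u)+k(w,v)+m\qquad(m\in\mathbb{N})$$ for all $u,v,w\in V$, where $n_0$ is the highest integer such that $u_{n_0}v\neq0$. The same integers may also be taken in weak commutativity for the vertex operator algebra $V$.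
   Context: $\mathbb{N}$ denotes the nonnegative integers. A vertex operator algebra $(V,Y,\mathbf 1,\omega)$ is in the standard sense of Frenkel–Lepowsky–Meurman, with $Y(v,x)=\sum_{n\in\mathbb{Z}}v_nx^{-n-1}$. An automorphism of $V$ is a linear automorphism $\nu$ of $V$ fixing $\mathbf 1$ and $\omega$ with $\nu Y(v,x)\nu^{-1}=Y(\nu v,x)$ for $v\in V$. A generating subset $U\subset V$ is a subset such that all elements of $V$ can be written as linear combinations of elements of the form $u_mv_n\cdots\mathbf 1$ for $u,v,\ldots\in U$ and $m,n,\ldots\in\mathbb{Z}$. Formal calculus conventions. $x^{1/p}$ is a formal variable whose $p$-th power is $x$. Binomial expansion convention: powers (integral or fractional) of binomials are expanded in nonnegative integral powers of the second variable. The formal limit $\lim_{x_1^{1/p}\to\omega_p^s(x_2+x_0)^{1/p}}G$ means that each integral power of $x_1^{1/p}$ in the formal series $G$ is replaced by the corresponding power of the formal series $\omega_p^s(x_2+x_0)^{1/p}$. Weak commutativity for $Y_M$, for $u,v$ with exponent $k\in\mathbb{N}$: $$(x_2-x_1)^kY_M(v,x_2)Y_M(u,x_1)=(x_2-x_1)^kY_M(u,x_1)Y_M(v,x_2).$$ Weak commutativity for the vertex operator algebra $V$, for $u,v$ with exponent $k$, is the same identity with $Y_M$ replaced by $Y$. Modified weak associativity for the ordered pair $u,v$ with exponent $k\in\mathbb{N}$: for every $s\in\mathbb{Z}$ the limit below is well defined and $$\lim_{x_1^{1/p}\to\omega_p^s(x_2+x_0)^{1/p}}\Big((x_1-x_2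)^kY_M(u,x_1)Y_M(v,x_2)\Big)=x_0^kY_M(Y(\nu^{-s}u,x_0)v,x_2).$$
   Formalization: No function k satisfies the formula as an equation (take u=v=1), so it is proved as: whenever k(w,u), k(w,v) are valid exponents, k(w,u)+k(w,v)+m is one for u_{n_0-m}v, w; generating words must contain at least one factor from U, since Y_M(1,x)=1 is not assumed. *)

(* Defs.v *)
From HB Require Import structures.
From mathcomp Require Import all_boot all_order all_algebra.
From mathcomp Require Import complex.
From mathcomp Require Import boolp classical_sets cardinality fsbigop reals.

Set Implicit Arguments.
Unset Strict Implicit.
Unset Printing Implicit Defensive.
Import Order.TTheory GRing.Theory Num.Theory.
Local Open Scope classical_set_scope.
Local Open Scope ring_scope.

Definition gbinom (K : fieldType) (x : K) (i : nat) : K :=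
  (\prod_(j < i) (x - j%:R)) / i`!%:R.

(* Formal series in x^(1/p) are indexed by e : int, the exponent of x^(1/p);
   series with coefficients in End W are handled through their values on an
   arbitrary vector of W. *)
Section FormalCalculus.
Variables (K : fieldType) (W : lmodType K) (p : nat).

(* If A v j is the mode v_(j/p), then fcoef A v e is the coefficient of x^(e/p)
   in sum_j v_(j/p) x^(-j/p-1). *)
Definition fcoef (V : Type) (A : V -> int -> W -> W) (v : V) (e : int) (w : W)
  : W := A v (- e - p%:Z) w.

(* The coefficient of x1^(a/p) x2^(b/p) in (x1 - x2)^k F(x1, x2). *)
Definition binom_mul (k : nat) (F : int -> int -> W) (a b : int) : W :=
  \sum_(i < k.+1) ((-1) ^+ i * 'C(k, i)%:R : K) *:
     F (a - (p * (k - i))%N%:Z) (b - (p * i)%N%:Z).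

(* Under x1^(1/p) -> omega^s (x2 + x0)^(1/p), the coefficient of x0^i x2^(c/p)
   in the limit of G(x1, x2) is the sum over a : int of these terms; the term
   of index a comes from x1^(a/p) x2^(c/p + i - a/p). *)
Definition limit_term (omega : K) (s : int) (G : int -> int -> W)
    (i : nat) (c a : int) : W :=
  (omega ^ (s * a) * gbinom (a%:~R / p%:R) i) *: G a (c + (p * i)%N%:Z - a).

Definition limit_defined (omega : K) (s : int) (G : int -> int -> W) : Prop :=
  forall (i : nat) (c : int),
    finite_set [set a : int | limit_term omega s G i c a != 0].

Definition limit_coef (omega : K) (s : int) (G : int -> int -> W)
    (i c : int) : W :=
  match i with
  | Posz i => \sum_(a \in [set: int]) limit_term omega s G i c a
  | Negz _ => 0
  end.

(* The coefficient of x1^(a/p) x2^(b/p) on both sides, (x2 - x1)^k being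
   expanded with x2 as the first variable. *)
Definition weak_commutativity (V : Type) (A : V -> int -> W -> W)
    (u v : V) (k : nat) : Prop :=
  forall (w : W) (a b : int),
    binom_mul k (fun b a => fcoef A v b (fcoef A u a w)) b a =
    binom_mul k (fun b a => fcoef A u a (fcoef A v b w)) b a.

End FormalCalculus.

Section VOA.
Variables (K : fieldType) (V : lmodType K).

(* vmode u n v is u_n v. *)
Record voa := Voa {
  vmode : V -> int -> V -> V;
  vac : V;
  conformal : V;
  central_charge : K;
  grade : int -> set V;
  vmode_linearl : forall n w, linear (fun v => vmode v n w);
  vmode_linearr : forall v n, linear (vmode v n);
  vmode_trunc : forall u v, exists N : int, forall n, N <= n -> vmode u n v = 0;
  grade0 : forall n, grade n 0;
  gradeP : forall n (a : K) u v, grade n u -> grade n v -> grade n (a *: u + v);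
  grade_direct : forall v, exists! f : int -> V,
    [/\ forall n, grade n (f n), finite_set [set n | f n != 0] &
        v = \sum_(n \in [set: int]) f n];
  grade_findim : forall n, exists (d : nat) (e : 'I_d -> V),
    forall v, grade n v -> exists c : 'I_d -> K, v = \sum_(i < d) c i *: e i;
  grade_bounded : exists N : int, forall n v, n < N -> grade n v -> v = 0;
  vac_grade : grade 0 vac;
  conformal_grade : grade 2 conformal;
  vac_identity : forall n v, vmode vac n v = if n == -1 then v else 0;
  creation : forall v,
    vmode v (-1) vac = v /\ forall n, 0 <= n -> vmode v n vac = 0;
  (* the coefficient of x0^(-l-1) x1^(-m-1) x2^(-n-1) in the Jacobi identity *)
  jacobi : forall u v w (l m n : int),
    \sum_(i \in [set: nat]) ((-1) ^+ i * gbinom (l%:~R : K) i) *: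
       (vmode u (m + l - i%:Z) (vmode v (n + i%:Z) w)
        - ((-1) ^ l : K) *: vmode v (n + l - i%:Z) (vmode u (m + i%:Z) w))
    = \sum_(i \in [set: nat]) gbinom (m%:~R : K) i *:
       vmode (vmode u (l + i%:Z) v) (m + n - i%:Z) w;
  (* conformal_(n+1) = L(n) *)
  virasoro : forall (m n : int) v,
    vmode conformal (m + 1) (vmode conformal (n + 1) v)
    - vmode conformal (n + 1) (vmode conformal (m + 1) v)
    = (m - n)%:~R *: vmode conformal (m + n + 1) v
      + (if m + n == 0
         then ((m ^+ 3 - m)%:~R / 12%:R * central_charge) *: v else 0);
  L0_grade : forall n v, grade n v -> vmode conformal 1 v = n%:~R *: v;
  L_1_derivative : forall v n w,
    vmode (vmode conformal 0 v) n w = - n%:~R *: vmode v (n - 1) w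
}.

Variable X : voa.

Record voa_aut := VoaAut {
  aut : V -> V;
  aut_inv : V -> V;
  aut_linear : linear aut;
  autK : cancel aut aut_inv;
  aut_invK : cancel aut_inv aut;
  aut_vac : aut (vac X) = vac X;
  aut_conformal : aut (conformal X) = conformal X;
  aut_vmode : forall v n w,
    aut (vmode X v n (aut_inv w)) = vmode X (aut v) n w
}.

Definition aut_pow (nu : voa_aut) (s : int) (v : V) : V :=
  match s with
  | Posz n => iter n (aut nu) v
  | Negz n => iter n.+1 (aut_inv nu) v
  end.

(* Words contain at least one mode of an element of U. Were the bare vacuum also
   a word, the empty set would generate V = K vac, which would leave
   Y_M(vac, x) unconstrained; when Y_M(vac, x) = 1, that convention is recovered
   by adding vac to U, since vac = vac_(-1) vac. *)
Inductive mode_word (U : set V) : V -> Prop :=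
| ModeWordVac u n : U u -> mode_word U (vmode X u n (vac X))
| ModeWordCons u n v : U u -> mode_word U v -> mode_word U (vmode X u n v).

Definition generating (U : set V) : Prop :=
  forall v, exists (d : nat) (c : 'I_d -> K) (f : 'I_d -> V),
    (forall i, mode_word U (f i)) /\ v = \sum_(i < d) c i *: f i.

Definition highest_mode (u v : V) (n0 : int) : Prop :=
  vmode X u n0 v <> 0 /\ forall n, n0 < n -> vmode X u n v = 0.

Variables (M : lmodType K) (p : nat) (omega : K) (nu : voa_aut).
Variable (YM : V -> int -> M -> M).

(* i is the exponent of x0 and c that of x2^(1/p). *)
Definition modified_weak_associativity (u v : V) (k : nat) : Prop :=
  forall (s : int) (w : M),
    let G := binom_mul p k (fun a b => fcoef p YM u a (fcoef p YM v b w)) in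
    limit_defined p omega s G /\
    forall i c : int,
      limit_coef p omega s G i c =
      fcoef p YM
        (fcoef 1 (vmode X) (aut_pow nu (- s) u) (i - k%:Z) v) c w.

Definition comm_exponent (u v : V) (k : nat) : Prop :=
  weak_commutativity p YM u v k /\ weak_commutativity 1 (vmode X) u v k.

Definition lowest_comm_exponent (u v : V) (k : nat) : Prop :=
  comm_exponent u v k /\ forall n, comm_exponent u v n -> (k <= n)%N.

Definition common_exponent (u v : V) (k : nat) : Prop :=
  comm_exponent u v k /\ modified_weak_associativity u v k.

End VOA.

(* Main.v *)
(* Multiplying by powers of x_i - x_j turns weak commutativity into the statement
   that products of vertex operators applied to a vector are bounded below in
   every variable, so that all formal limits exist and the powers can be
   cancelled afterwards; in particular the exponent of modified weak
   associativity can be lowered to that of weak commutativity.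

   V is spanned by the words u1_n1 ... ur_nr u with all letters in U: this span is
   stable under all modes of V, hence under L(-1), so it contains u_n vac for u
   in U. Weak commutativity for w with u and with v passes to u_n v by
   substituting x1 -> x2 + x0 in the commutator of Y_M(w, x3) with
   Y_M(u, x1) Y_M(v, x2), which also gives the formula for the exponents.
   Modified weak associativity passes from w and u to w_n u by computing the
   limit of (x1 - x2)^k (x1 - x3)^k (x2 - x3)^g Y_M(w, x1) Y_M(u, x2) Y_M(v, x3)
   in two orders. One order gives the limits for the w_n u, the other gives
   Y_M of a universal expression in V, which is identified by applying the same
   computation to V as a module over itself with trivial automorphism. *)

Require Import Defs.
From HB Require Import structures.
From mathcomp Require Import all_boot all_order all_algebra.
From mathcomp Require Import complex.
From mathcomp Require Import boolp classical_sets cardinality fsbigop reals.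
From mathcomp Require Import zify ring.

Set Implicit Arguments.
Unset Strict Implicit.
Unset Printing Implicit Defensive.
Import Order.TTheory GRing.Theory Num.Theory.
Local Open Scope classical_set_scope.
Local Open Scope ring_scope.

(** * Sums of finitely supported families *)

(** [M] carries no grading, so everything is done with families of coefficients and with the
    finiteness of their antidiagonals. Weak commutativity for u_n v needs associativity only for u
    in [U] and s = 0, which is given against every v; hence it is settled before anything else, for
    [U] against V and then by symmetry for V against V. Associativity for w_n u needs commutativity
    of all pairs, because the vectors w_n u themselves must be commuted past v. The obstacle is that
    the available exponents for u_(n0-m) v grow with m, so one power of x1 - x3 is not at hand for
    all powers of x0 together. Limits are therefore compared coefficient by coefficient:
    multiplication by x1 - x3 - x0 or by y + x0 looks only at equal or lower coefficients,
    truncation bounds these from below, and the finitely many exponents that remain have a common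
    bound. The factor (y + x0)^k left over in the comparison is cancelled because it is injective on
    series bounded below in y. *)

Section FiniteSupport.
Variables (T : choiceType) (K : fieldType) (W : lmodType K).
Implicit Types f g : T -> W.

Definition fsupp f : Prop := exists r : seq T, forall a, f a != 0 -> a \in r.

Definition tsum f : W := \sum_(a \in [set: T]) f a.

Lemma fsuppP f : finite_set [set a | f a != 0] <-> fsupp f.
Proof.
split=> [/finite_seqP[r Er]|[r fr]].
  by exists r => a fa; have : [set` r] a by rewrite -Er.
by apply: (sub_finite_set _ (finite_seq r)) => a; apply: fr.
Qed.

Lemma tsum_seq f r :
  uniq r -> (forall a, f a != 0 -> a \in r) -> tsum f = \sum_(a <- r) f a.
Proof.
move=> ur fr; rewrite fsbig_seq //; apply/esym/fsbig_widen => // a [_ /= /negP ar].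
by apply/eqP; apply: contraNT ar; apply: fr.
Qed.

Lemma eq_tsum f g : f =1 g -> tsum f = tsum g.
Proof. by move=> fg; rewrite (funext fg). Qed.

Lemma tsum0 f : (forall a, f a = 0) -> tsum f = 0.
Proof. by move=> f0; rewrite (tsum_seq (r := [::])) ?big_nil // => a; rewrite f0 eqxx. Qed.

Lemma tsum1 f b : (forall a, a != b -> f a = 0) -> tsum f = f b.
Proof.
move=> f0; rewrite (tsum_seq (r := [:: b])) ?big_seq1 // => a fa.
by rewrite inE; apply: contraNT fa => /f0 ->.
Qed.

Lemma fsupp_sub f g : fsupp f -> (forall a, f a = 0 -> g a = 0) -> fsupp g.
Proof.
move=> [r fr] fg; exists r => a ga; apply: fr.
by apply: contraNN ga => /eqP/fg ->.
Qed.

Lemma fsuppD f g : fsupp f -> fsupp g -> fsupp (fun a => f a + g a).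
Proof.
move=> [r fr] [q gq]; exists (r ++ q) => a; rewrite mem_cat.
apply: contraNT; rewrite negb_or => /andP[/(contraNT (fr a)) /eqP ->].
by move=> /(contraNT (gq a)) /eqP ->; rewrite addr0.
Qed.

Lemma tsumD f g : fsupp f -> fsupp g ->
  tsum (fun a => f a + g a) = tsum f + tsum g.
Proof.
move=> [r fr] [q gq]; pose t := undup (r ++ q).
have tE a : (a \in t) = (a \in r) || (a \in q) by rewrite mem_undup mem_cat.
rewrite !(tsum_seq (r := t)) ?undup_uniq //; first by rewrite big_split.
- by move=> a /gq; rewrite tE orbC => ->.
- by move=> a /fr; rewrite tE => ->.
move=> a; rewrite tE; apply: contraNT; rewrite negb_or => /andP[].
move=> /(contraNT (fr a)) /eqP -> /(contraNT (gq a)) /eqP ->.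
by rewrite addr0.
Qed.

(** No finiteness is assumed: for infinite support and k <> 0 both sums take the default value 0. *)
Lemma tsumZ (k : K) f : tsum (fun a => k *: f a) = k *: tsum f.
Proof.
have [->|k0] := eqVneq k 0; first by rewrite scale0r tsum0 // => a; rewrite scale0r.
have [[r fr]|nf] := pselect (fsupp f).
  rewrite !(tsum_seq (r := undup r)) ?undup_uniq ?scaler_sumr // => a.
    by rewrite mem_undup; apply: fr.
  by rewrite mem_undup scaler_eq0 negb_or => /andP[_]; apply: fr.
have H (h : T -> W) : ~ fsupp h -> tsum h = 0.
  move=> nh; rewrite /tsum fsbig_dflt //; apply: contra_not nh => nh.
  apply/fsuppP; apply: sub_finite_set nh => a /= /eqP ha.
  by split.
rewrite !H ?scaler0 //; apply: contra_not nf => nf.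
by apply: (fsupp_sub nf) => a /eqP; rewrite scaler_eq0 (negPf k0) => /eqP.
Qed.

End FiniteSupport.

Section FiniteSupportMaps.
Variables (K : fieldType) (W W' : lmodType K).

Lemma lin0 (h : W -> W') : linear h -> h 0 = 0.
Proof. by move=> lh; have := lh (-1) 0 0; rewrite !scaler0 addr0 scaleN1r addNr. Qed.

Lemma linD (h : W -> W') x y : linear h -> h (x + y) = h x + h y.
Proof. by move=> lh; have := lh 1 x y; rewrite !scale1r. Qed.

Lemma linZ (h : W -> W') k x : linear h -> h (k *: x) = k *: h x.
Proof. by move=> lh; have := lh k x 0; rewrite lin0 // !addr0. Qed.

Lemma linN (h : W -> W') x : linear h -> h (- x) = - h x.
Proof. by move=> lh; rewrite -scaleN1r linZ // scaleN1r. Qed.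

Lemma linB (h : W -> W') x y : linear h -> h (x - y) = h x - h y.
Proof. by move=> lh; rewrite linD // linN. Qed.

Lemma lin_sum (h : W -> W') (I : Type) (r : seq I) (P : pred I) (F : I -> W) :
  linear h -> h (\sum_(i <- r | P i) F i) = \sum_(i <- r | P i) h (F i).
Proof.
by move=> lh; apply: (big_morph h) => [x y|]; rewrite ?linD ?lin0.
Qed.

Lemma tsum_lin (T : choiceType) (h : W -> W') (f : T -> W) :
  linear h -> fsupp f -> tsum (fun a => h (f a)) = h (tsum f).
Proof.
move=> lh [r fr]; rewrite !(tsum_seq (r := undup r)) ?undup_uniq ?lin_sum //.
  by move=> a; rewrite mem_undup; apply: fr.
move=> a; rewrite mem_undup; apply: contraNT => /(contraNT (fr a)) /eqP ->.
by rewrite lin0.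
Qed.

Lemma fsupp_reindex (T T' : choiceType) (h : T' -> T) (h' : T -> T') (f : T -> W) :
  cancel h h' -> fsupp f -> fsupp (fun a => f (h a)).
Proof.
move=> hK [r fr]; exists (map h' r) => a /fr ar.
by rewrite -[a]hK map_f.
Qed.

Lemma tsum_reindex (T T' : choiceType) (h : T' -> T) (h' : T -> T') (f : T -> W) :
  cancel h h' -> cancel h' h -> tsum (fun a => f (h a)) = tsum f.
Proof. by move=> hK h'K; rewrite /tsum -(reindex_fsbigT h) //; exists h'. Qed.

Lemma tsum_exchange (T T' : choiceType) (r : seq T) (r' : seq T')
    (f : T -> T' -> W) :
  (forall a b, f a b != 0 -> (a \in r) && (b \in r')) ->
  tsum (fun a => tsum (f a)) = tsum (fun b => tsum (fun a => f a b)).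
Proof.
move=> fr; pose s := undup r; pose s' := undup r'.
have fs a b : f a b != 0 -> (a \in s) && (b \in s').
  by rewrite !mem_undup; apply: fr.
have E1 a : tsum (f a) = \sum_(b <- s') f a b.
  by rewrite (tsum_seq (r := s')) ?undup_uniq // => b /fs /andP[].
have E2 b : tsum (fun a => f a b) = \sum_(a <- s) f a b.
  by rewrite (tsum_seq (r := s)) ?undup_uniq // => a /fs /andP[].
rewrite (eq_tsum E1) (eq_tsum E2).
rewrite (tsum_seq (r := s)) ?undup_uniq // => [|a]; last first.
  apply: contraNT => as_; rewrite big1 // => b _.
  by apply/eqP; apply: contraNT as_ => /fs /andP[].
rewrite (tsum_seq (r := s')) ?undup_uniq // => [|b]; last first.
  apply: contraNT => bs; rewrite big1 // => a _.
  by apply/eqP; apply: contraNT bs => /fs /andP[].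
exact: exchange_big.
Qed.

End FiniteSupportMaps.

Section IntegerSums.
Variables (K : fieldType) (W : lmodType K).

Lemma tsum_shift (f : int -> W) (c : int) : tsum (fun a => f (a + c)) = tsum f.
Proof. exact: (tsum_reindex _ (addrK c) (addrNK c)). Qed.

Lemma fsupp_shift (f : int -> W) (c : int) : fsupp f -> fsupp (fun a => f (a + c)).
Proof. exact: (fsupp_reindex (addrK c)). Qed.

Definition int_range (l h : int) : seq int :=
  [seq l + k%:Z | k <- iota 0 `|h - l|%N.+1].

Lemma mem_int_range (l h a : int) : l <= a -> a <= h -> a \in int_range l h.
Proof.
move=> la ah; apply/mapP; exists `|a - l|%N; last by lia.
by rewrite mem_iota; lia.
Qed.

Lemma fsupp_bounded (f : int -> W) (l h : int) :
  (forall a, a < l -> f a = 0) -> (forall a, h < a -> f a = 0) -> fsupp f.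
Proof.
move=> fl fh; exists (int_range l h) => a fa.
apply: mem_int_range; rewrite leNgt; apply: contraNN fa => ?.
  by rewrite fl.
by rewrite fh.
Qed.

Lemma tsum_nat (f : int -> W) (l : int) : (forall a, a < l -> f a = 0) ->
  tsum f = tsum (fun i : nat => f (l + i%:Z)).
Proof.
move=> fl; rewrite /tsum.
transitivity (\sum_(a \in [set a : int | l <= a]) f a).
  by apply/esym/fsbig_widen => // a [_ /= /negP]; rewrite -ltNge => /fl.
apply: (reindex_fsbig (fun i : nat => l + i%:Z)); split => //.
- by move=> i _ /=; lia.
- by move=> i j _ _; lia.
by move=> a /= la; exists `|a - l|%N => //; lia.
Qed.

End IntegerSums.

(** * Generalized binomial coefficients *)

Section GeneralizedBinomials.
Variable K : numFieldType.
Implicit Types x y : K.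

Lemma gbinom0 x : gbinom x 0 = 1.
Proof. by rewrite /gbinom big_ord0 fact0 divr1. Qed.

Lemma gbinomS x i : gbinom x i.+1 = gbinom x i * (x - i%:R) / i.+1%:R.
Proof.
by rewrite /gbinom big_ord_recr /= factS natrM invfM; ring.
Qed.

Lemma gbinomD1 x i : gbinom (x + 1) i.+1 = gbinom x i.+1 + gbinom x i.
Proof.
elim: i => [|i IH]; first by rewrite !gbinomS !gbinom0 subr0 !invr1; ring.
rewrite [LHS]gbinomS IH [gbinom x i.+2]gbinomS [gbinom x i.+1]gbinomS.
have i1 : (i%:R + 1 : K) != 0 by rewrite natr1 pnatr_eq0.
have i2 : (i%:R + 1 + 1 : K) != 0 by rewrite !natr1 pnatr_eq0.
rewrite -!natr1; field.
by rewrite i1 i2.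
Qed.

Lemma gbinom_nat n i : gbinom (n%:R : K) i = 'C(n, i)%:R.
Proof.
elim: n i => [|n IH] [|i]; rewrite ?gbinom0 ?bin0 //.
  by rewrite /gbinom big_ord_recl subrr !mul0r bin0n.
by rewrite -natr1 gbinomD1 !IH binS natrD.
Qed.

(** Induction on j after multiplying by j + 1. In the l-th term this factor is split as l + (j + 1 -
    l); each half lowers one of the two binomials, and the resulting factors x - l and y - (j - l)
    add up to x + y - j. *)
Lemma vandermonde x y j :
  gbinom (x + y) j = \sum_(l < j.+1) gbinom x l * gbinom y (j - l).
Proof.
elim: j => [|j IH]; first by rewrite big_ord1 subnn !gbinom0 mul1r.
have j1 : (j.+1%:R : K) != 0 by rewrite pnatr_eq0.
apply: (mulIf j1); rewrite gbinomS mulfVK // IH.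
have stp (z : K) l : gbinom z l.+1 * l.+1%:R = gbinom z l * (z - l%:R).
  by rewrite gbinomS mulfVK // pnatr_eq0.
pose t l := gbinom x l * gbinom y (j.+1 - l).
have E1 : \sum_(l < j.+2) t l * l%:R = \sum_(l < j.+1) t l.+1 * l.+1%:R.
  by rewrite big_ord_recl mulr0 add0r.
have E2 : \sum_(l < j.+2) t l * (j.+1 - l)%:R = \sum_(l < j.+1) t l * (j.+1 - l)%:R.
  by rewrite big_ord_recr /= subnn mulr0 addr0.
transitivity (\sum_(l < j.+2) t l * j.+1%:R); last by rewrite mulr_suml.
transitivity (\sum_(l < j.+2) (t l * l%:R + t l * (j.+1 - l)%:R)); last first.
  by apply: eq_bigr => l _; rewrite -mulrDr -natrD addnC subnK // -ltnS.
rewrite big_split /= E1 E2 -big_split /= mulr_suml.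
apply: eq_bigr => l _; rewrite /t.
have lj : (l <= j)%N by rewrite -ltnS ltn_ord.
rewrite subSS (mulrAC (gbinom x l.+1)) stp subSn //.
rewrite -(mulrA (gbinom x l) (gbinom y (j - l).+1)) stp natrB //.
by ring.
Qed.

Lemma gbinom_revision x i l :
  gbinom x (i + l) * 'C(i + l, i)%:R = gbinom x i * gbinom (x - i%:R) l.
Proof.
elim: l => [|l IH]; first by rewrite addn0 binn mulr1 gbinom0 mulr1.
have l1 : (l.+1%:R : K) != 0 by rewrite pnatr_eq0.
have il : ((i + l).+1%:R : K) != 0 by rewrite pnatr_eq0.
have E : ('C((i + l).+1, i) * l.+1 = (i + l).+1 * 'C(i + l, i))%N.
  by rewrite (mul_bin_down (i + l).+1) subSn ?leq_addr // addKn mulnC.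
apply: (mulIf l1); rewrite addnS -mulrA -natrM E natrM mulrA.
rewrite gbinomS mulfVK // mulrAC IH [in RHS]gbinomS mulrA mulfVK //.
by rewrite natrD; ring.
Qed.

End GeneralizedBinomials.

(** * Formal limits *)

Section Differences.
Variables (K : numFieldType) (W : lmodType K) (p : nat).
Implicit Types F G : int -> int -> W.

(* Multiplication by x1 - x2. *)
Definition dif F (a b : int) : W := F (a - p%:Z) b - F a (b - p%:Z).

Lemma difE F a b : dif F a b = F (a - p%:Z) b - F a (b - p%:Z).
Proof. by []. Qed.

(** Pascal's rule; from here on a statement about (x1 - x2)^k is an induction over single
    factors. *)
Lemma binom_mulE k F : binom_mul p k F = iter k dif F.
Proof.
elim: k F => [|k IH] F.
  apply/funext => a; apply/funext => b.
  by rewrite /binom_mul big_ord1 expr0 bin0 mulr1 scale1r subnn muln0 !subr0.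
rewrite iterSr -IH; apply/funext => a; apply/funext => b; rewrite /binom_mul.
pose G i := F (a - (p * (k.+1 - i))%N%:Z) (b - (p * i)%N%:Z).
pose c i : K := (-1) ^+ i * 'C(k, i)%:R.
transitivity (\sum_(i < k.+1) c i *: (G i - G i.+1)); last first.
  apply: eq_bigr => i _; congr (_ *: (F _ _ - F _ _)).
  - by rewrite subSn ?mulnS 1?PoszD; [lia | rewrite -ltnS].
  - by rewrite mulnS PoszD; lia.
transitivity (\sum_(i < k.+2) c i *: G i - \sum_(i < k.+1) c i *: G i.+1).
  rewrite [LHS]big_ord_recl [\sum_(i < k.+2) _]big_ord_recl -addrA -sumrB; congr (_ + _).
    by rewrite /c !bin0.
  apply: eq_bigr => i _; rewrite -scalerBl /c /bump /= ?add1n; congr (_ *: _).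
  by rewrite binS natrD exprS; ring.
rewrite big_ord_recr /= [c k.+1]/c bin_small // mulr0 scale0r addr0 -sumrB.
by apply: eq_bigr => i _; rewrite scalerBr.
Qed.

End Differences.

Section Limits.
Variables (K : numFieldType) (W : lmodType K) (p : nat) (omega : K).
Implicit Types (F G : int -> int -> W) (s i c a b : int).

Definition fin_diag G : Prop := forall c, fsupp (fun a => G a (c - a)).

Lemma fin_diag_sub F G : fin_diag F -> (forall a b, F a b = 0 -> G a b = 0) ->
  fin_diag G.
Proof. by move=> Ff FG c; apply: (fsupp_sub (Ff c)) => a; apply: FG. Qed.

Lemma fin_diagD F G : fin_diag F -> fin_diag G -> fin_diag (fun a b => F a b + G a b).
Proof. by move=> Ff Gf c; apply: fsuppD. Qed.

Lemma fin_diagZ k G : fin_diag G -> fin_diag (fun a b => k *: G a b).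
Proof. by move=> Gf; apply: (fin_diag_sub Gf) => a b ->; rewrite scaler0. Qed.

Lemma fin_diag_x1 G : fin_diag G -> fin_diag (fun a b => G (a - p%:Z) b).
Proof.
move=> Gf c; apply: (fsupp_sub (fsupp_shift (- p%:Z) (Gf (c - p%:Z)))) => a <-.
by congr G; lia.
Qed.

Lemma fin_diag_x2 G : fin_diag G -> fin_diag (fun a b => G a (b - p%:Z)).
Proof.
move=> Gf c; apply: (fsupp_sub (Gf (c - p%:Z))) => a <-.
by congr G; lia.
Qed.

Lemma fin_diag_dif G : fin_diag G -> fin_diag (dif p G).
Proof.
move=> Gf; have G2 := fin_diagZ (-1) (fin_diag_x2 Gf).
apply: (fin_diag_sub (fin_diagD (fin_diag_x1 Gf) G2)) => a b <-.
by rewrite scaleN1r.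
Qed.

Lemma fin_diag_iter_dif k G : fin_diag G -> fin_diag (iter k (dif p) G).
Proof. by move=> Gf; elim: k => //= k; apply: fin_diag_dif. Qed.

Lemma eq_limit s F G i c :
  (forall a b, F a b = G a b) -> limit_coef p omega s F i c = limit_coef p omega s G i c.
Proof. by move=> FG; congr limit_coef; apply/funext => a; apply/funext. Qed.

Lemma limit_neg s G n c : limit_coef p omega s G (Negz n) c = 0.
Proof. by []. Qed.

Lemma limit0 s i c : limit_coef p omega s (fun _ _ => 0 : W) i c = 0.
Proof. by case: i => // i; apply: tsum0 => a; rewrite /limit_term scaler0. Qed.

Lemma limitZ s k G i c :
  limit_coef p omega s (fun a b => k *: G a b) i c = k *: limit_coef p omega s G i c.
Proof.
case: i => [i|i]; last by rewrite scaler0.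
rewrite -tsumZ; apply: eq_tsum => a.
by rewrite /limit_term !scalerA mulrC.
Qed.

Lemma limit_x2 s G i c :
  limit_coef p omega s (fun a b => G a (b - p%:Z)) i c =
  limit_coef p omega s G i (c - p%:Z).
Proof.
case: i => // i; apply: eq_tsum => a.
by rewrite /limit_term; congr (_ *: G _ _); lia.
Qed.

Hypotheses (p_gt0 : (0 < p)%N) (omega_p : omega ^+ p = 1).

Lemma omega_neq0 : omega != 0.
Proof.
apply/eqP => o0; move/eqP: omega_p.
by rewrite o0 expr0n eqn0Ngt p_gt0 eq_sym oner_eq0.
Qed.

Lemma omega_shift s a : omega ^ (s * (a + p%:Z)) = omega ^ (s * a).
Proof.
rewrite mulrDr expfzDr ?omega_neq0 // [s * p%:Z]mulrC -(exprz_exp _ p%:Z) -exprnP.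
by rewrite omega_p exp1rz mulr1.
Qed.

(** The coefficient of x0^0 weights each entry of an antidiagonal by a power of [omega], which is
    nonzero, so it alone forces finiteness; the criterion no longer involves s. *)
Lemma limit_definedP s G : limit_defined p omega s G <-> fin_diag G.
Proof.
split=> [Gfin c|Gfin i c].
  apply: (fsupp_sub (proj1 (fsuppP _) (Gfin 0%N c))) => a /eqP.
  rewrite /limit_term gbinom0 mulr1 muln0 addr0 scaler_eq0.
  by rewrite expfz_eq0 (negPf omega_neq0) andbF => /eqP.
apply/fsuppP; apply: (fsupp_sub (Gfin (c + (p * i)%N%:Z))) => a.
by rewrite /limit_term => ->; rewrite scaler0.
Qed.

Lemma fsupp_term s G (i : nat) c : fin_diag G -> fsupp (limit_term p omega s G i c).
Proof. by move=> /(limit_definedP s) Gfin; apply/fsuppP. Qed.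

Lemma limitD s F G i c : fin_diag F -> fin_diag G ->
  limit_coef p omega s (fun a b => F a b + G a b) i c =
  limit_coef p omega s F i c + limit_coef p omega s G i c.
Proof.
case: i => [i|i] Ff Gf; last by rewrite addr0.
rewrite -tsumD; try exact: fsupp_term.
by apply: eq_tsum => a; rewrite /limit_term scalerDr.
Qed.

(** Since omega^p = 1, x1 itself becomes x2 + x0; on coefficients this is Pascal's rule for the
    binomials of a/p. *)
Lemma limit_x1 s G i c : fin_diag G ->
  limit_coef p omega s (fun a b => G (a - p%:Z) b) i c =
  limit_coef p omega s G i (c - p%:Z) + limit_coef p omega s G (i - 1) c.
Proof.
have p0 : (p%:R : K) != 0 by rewrite pnatr_eq0 -lt0n.
have pE a : (a + p%:Z)%:~R / p%:R = a%:~R / p%:R + 1 :> K.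
  by rewrite intrD mulrDl divff.
case: i => [[|i]|i] Gfin; last first.
- have -> : Negz i - 1 = Negz i.+1 by lia.
  by rewrite !limit_neg addr0.
- have -> : Posz i.+1 - 1 = Posz i by lia.
  rewrite /limit_coef -![\sum_(a \in _) _]/(tsum _) -tsumD; try exact: fsupp_term.
  rewrite -(tsum_shift _ p%:Z); apply: eq_tsum => a.
  rewrite /limit_term omega_shift addrK pE gbinomD1 mulrDr scalerDl.
  by congr (_ *: G _ _ + _ *: G _ _); rewrite ?mulnS ?PoszD; lia.
(* For i = 0 the second term is a coefficient of x0^(-1), zero by definition. *)
rewrite [in X in _ + X]/limit_coef /= addr0.
rewrite /limit_coef -![\sum_(a \in _) _]/(tsum _) -(tsum_shift _ p%:Z).
apply: eq_tsum => a; rewrite /limit_term omega_shift addrK !gbinom0.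
by congr (_ *: G _ _); lia.
Qed.

Lemma limit_dif s G i c : fin_diag G ->
  limit_coef p omega s (dif p G) i c = limit_coef p omega s G (i - 1) c.
Proof.
move=> Gf.
transitivity (limit_coef p omega s
    (fun a b => G (a - p%:Z) b + (-1) *: G a (b - p%:Z)) i c).
  by apply: eq_limit => a b; rewrite scaleN1r.
rewrite limitD; [|exact: fin_diag_x1|exact/fin_diagZ/fin_diag_x2].
by rewrite limitZ limit_x1 // limit_x2 scaleN1r addrAC subrr add0r.
Qed.

Lemma limit_iter_dif s k G i c : fin_diag G ->
  limit_coef p omega s (iter k (dif p) G) i c = limit_coef p omega s G (i - k%:Z) c.
Proof.
move=> Gf; elim: k i => [|k IH] i; first by rewrite subr0.
rewrite /= limit_dif; last exact: fin_diag_iter_dif.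
by rewrite IH; congr limit_coef; lia.
Qed.

End Limits.

Lemma limit_lin (K : numFieldType) (W W' : lmodType K) (p : nat) (omega : K)
    (h : W -> W') s G i c : (0 < p)%N -> omega ^+ p = 1 -> linear h ->
  fin_diag G -> limit_coef p omega s (fun a b => h (G a b)) i c
  = h (limit_coef p omega s G i c).
Proof.
case: i => [i|i] p_gt0 omega_p lh Gf; last by rewrite /= lin0.
rewrite /limit_coef -![\sum_(a \in _) _]/(tsum _) -(tsum_lin lh); last first.
  exact: fsupp_term.
by apply: eq_tsum => a; rewrite /limit_term linZ.
Qed.

Lemma iter_comm (T : Type) (f g : T -> T) k l x :
  (forall y, f (g y) = g (f y)) -> iter k f (iter l g x) = iter l g (iter k f x).
Proof.
move=> fg; have fgl y : f (iter l g y) = iter l g (f y).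
  by elim: l => //= l IH; rewrite fg IH.
by elim: k => //= k ->; rewrite fgl.
Qed.

(** Used with h a formal limit and P the finiteness that every intermediate series has to keep. *)
Lemma iter_morph (T T' : Type) (h : T -> T') (f : T -> T) (g : T' -> T')
    (P : T -> Prop) k x :
  (forall y, P y -> P (f y)) -> (forall y, P y -> h (f y) = g (h y)) ->
  P x -> P (iter k f x) /\ h (iter k f x) = iter k g (h x).
Proof.
move=> Pf hf Px; elim: k => //= k [Pk IH].
by split; [exact: Pf | rewrite hf ?IH].
Qed.

Section IteratedDifferences.
Variables (K : numFieldType) (W : lmodType K) (p : nat).
Implicit Types F G : int -> int -> W.

Lemma iter_dif0 k F a b : (forall a b, F a b = 0) -> iter k (dif p) F a b = 0.
Proof.
by move=> F0; elim: k a b => //= k IH a b; rewrite /dif !IH subrr.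
Qed.

Lemma iter_difB k F G a b : iter k (dif p) (fun a b => F a b - G a b) a b =
  iter k (dif p) F a b - iter k (dif p) G a b.
Proof. by elim: k a b => //= k IH a b; rewrite !difE !IH; rewrite !opprD !opprK addrACA. Qed.

Lemma iter_difD k F G a b : iter k (dif p) (fun a b => F a b + G a b) a b =
  iter k (dif p) F a b + iter k (dif p) G a b.
Proof. by elim: k a b => //= k IH a b; rewrite !difE !IH; rewrite !opprD addrACA. Qed.

Lemma iter_dif_lin (W' : lmodType K) (h : W -> W') k F a b : linear h ->
  iter k (dif p) (fun a b => h (F a b)) a b = h (iter k (dif p) F a b).
Proof. by move=> lh; elim: k a b => //= k IH a b; rewrite /dif !IH linB. Qed.

Lemma iter_dif_flip k F a b :
  iter k (dif p) (fun b a => F a b) b a = (-1) ^+ k *: iter k (dif p) F a b.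
Proof.
elim: k a b => [|k IH] a b; first by rewrite scale1r.
rewrite /= !difE !IH exprS -scalerA scaleN1r.
by rewrite -scalerBr -scalerN opprB.
Qed.

Lemma iter_dif_low1 k F N : (forall a b, a < N -> F a b = 0) ->
  forall a b, a < N -> iter k (dif p) F a b = 0.
Proof.
move=> FN; elim: k => //= k IH a b aN; rewrite difE !IH ?subrr //.
by apply: le_lt_trans aN; rewrite gerBl.
Qed.

Lemma iter_dif_low2 k F N : (forall a b, b < N -> F a b = 0) ->
  forall a b, b < N -> iter k (dif p) F a b = 0.
Proof.
move=> FN; elim: k => //= k IH a b bN; rewrite difE !IH ?subrr //.
by apply: le_lt_trans bN; rewrite gerBl.
Qed.

Lemma fin_diag_low F N N' : (forall a b, a < N -> F a b = 0) ->
  (forall a b, b < N' -> F a b = 0) -> fin_diag F.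
Proof.
move=> F1 F2 c; apply: (@fsupp_bounded _ _ _ N (c - N')) => a aN; first exact: F1.
by apply: F2; lia.
Qed.

End IteratedDifferences.

(** * Multiplication operators in three variables *)

Section ThreeVariables.
Variables (K : numFieldType) (W : lmodType K) (p : nat).
Implicit Types (F : int -> int -> int -> W) (E : int -> int -> int -> W).
Implicit Types (a b c i j h s : int) (eps : K).

Definition dif12 F a b c : W := F (a - p%:Z) b c - F a (b - p%:Z) c.
Definition dif13 F a b c : W := F (a - p%:Z) b c - F a b (c - p%:Z).
Definition dif23 F a : int -> int -> W := dif p (F a).

Lemma dif12_13 F : dif12 (dif13 F) = dif13 (dif12 F).
Proof.
by do 3 apply/funext => ?; rewrite /dif12 /dif13 !opprD !opprK addrACA.
Qed.

Lemma dif12_23 F : dif12 (dif23 F) = dif23 (dif12 F).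
Proof.
by do 3 apply/funext => ?; rewrite /dif12 /dif23 /dif !opprD !opprK addrACA.
Qed.

Lemma dif13_23 F : dif13 (dif23 F) = dif23 (dif13 F).
Proof.
by do 3 apply/funext => ?; rewrite /dif13 /dif23 /dif !opprD !opprK addrACA.
Qed.

Lemma iter_dif12E k F a b c :
  iter k dif12 F a b c = iter k (dif p) (fun a b => F a b c) a b.
Proof. by elim: k a b c => //= k IH a b c; rewrite /dif12 difE !IH. Qed.

Lemma iter_dif13E k F a b c :
  iter k dif13 F a b c = iter k (dif p) (fun a c => F a b c) a c.
Proof. by elim: k a b c => //= k IH a b c; rewrite /dif13 difE !IH. Qed.

Lemma iter_dif23E k F a : iter k dif23 F a = iter k (dif p) (F a).
Proof. by elim: k => //= k IH; rewrite /dif23 IH. Qed.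

(* E j is the coefficient of x0^j, and opS multiplies E by x1 - x2 + eps x0. *)
Definition opS eps E j a c : W := dif p (E j) a c + eps *: E (j - 1) a c.
Definition difF E j : int -> int -> W := dif p (E j).

(* Multiplication by y + eps x, the coefficient of x^j y^h being R j h. *)
Definition opF eps (R : int -> int -> W) j h : W :=
  R j (h - 1) + eps *: R (j - 1) h.

Lemma opFE eps R j h : opF eps R j h = R j (h - 1) + eps *: R (j - 1) h.
Proof. by []. Qed.

Lemma opSE eps E j a c :
  opS eps E j a c = dif p (E j) a c + eps *: E (j - 1) a c.
Proof. by []. Qed.

Lemma iter_difFE k E j : iter k difF E j = iter k (dif p) (E j).
Proof. by elim: k => //= k IH; rewrite /difF IH. Qed.

Lemma opF_eq_on k eps (R R' : int -> int -> W) (J : int) : (forall j h, j <= J -> R j h = R' j h) ->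
  forall j h, j <= J -> iter k (opF eps) R j h = iter k (opF eps) R' j h.
Proof.
move=> RR'; elim: k => //= k IH j h jJ; rewrite !opFE !IH //.
by apply: le_trans jJ; rewrite gerBl.
Qed.

(** The source of the summand m in the exponent formula. Multiplying the coefficient of x0^j by x1 -
    x2 gives that of (x1 - x2 - x0) E plus the previous coefficient of E: the former is handled by
    induction on k, the latter by induction on m. *)
Lemma opS_vanish k E j0 : (forall j a c, j < j0 -> E j a c = 0) ->
  (forall j a c, iter k (opS (-1)) E j a c = 0) ->
  forall m a c, iter (k + m) (dif p) (E (j0 + m%:Z)) a c = 0.
Proof.
elim: k E => [|k IH] E Elow; first by move=> E0 m a c; apply: iter_dif0.
rewrite iterSr => E0 m.
have low' j a c : j < j0 -> opS (-1) E j a c = 0.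
  move=> jj0; rewrite opSE difE !Elow ?subrr ?scaler0 ?addr0 //.
  by apply: le_lt_trans jj0; rewrite gerBl.
have {}IH := IH _ low' E0.
have step j : dif p (E j) = fun a c => opS (-1) E j a c + E (j - 1) a c.
  by do 2 apply/funext => ?; rewrite opSE scaleN1r addrNK.
elim: m => [|m IHm] a c; rewrite addSn iterSr step iter_difD.
  by rewrite IH add0r; apply: iter_dif0 => ? ?; rewrite Elow //; lia.
have -> : j0 + m.+1%:Z - 1 = j0 + m%:Z by lia.
by rewrite IH add0r addnS -addSn.
Qed.

(** Multiplication by y + x is injective on series bounded below in x, since the lowest power of x
    survives multiplied by y. Only coefficients of lower index in x enter, so the argument may stop
    at [I]. *)
Lemma opF_vanish k (R : int -> int -> W) (I : int) : (forall i j, i < 0 -> R i j = 0) ->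
  (forall i j, 0 <= i -> i <= I -> iter k (opF 1) R i j = 0) ->
  forall i j, i <= I -> R i j = 0.
Proof.
elim: k R => [|k IH] R Rlow.
  move=> R0 i j iI; have [/Rlow //|i0] := ltP i 0; exact: R0.
rewrite iterSr => R0.
have low' i j : i < 0 -> opF 1 R i j = 0.
  by move=> i0; rewrite !opFE !Rlow ?scaler0 ?addr0 //; lia.
have {}IH := IH _ low' R0.
have step n : forall i j, i <= I -> i < n%:Z -> R i j = 0.
  elim: n => [|n IHn] i j iI ilt; first exact: Rlow.
  have := IH i (j + 1) iI; rewrite !opFE addrK.
  by rewrite (IHn (i - 1)) ?scaler0 ?addr0 //; lia.
by move=> i j iI; apply: (step `|i|%N.+1) => //; lia.
Qed.

Lemma iter_opFB k eps (R R' : int -> int -> W) i j :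
  iter k (opF eps) (fun i j => R i j - R' i j) i j =
  iter k (opF eps) R i j - iter k (opF eps) R' i j.
Proof.
by elim: k i j => //= k IH i j; rewrite !opFE !IH scalerBr opprD addrACA.
Qed.

End ThreeVariables.

Lemma iter_opF_lin (K : numFieldType) (W W' : lmodType K) (g : W -> W') k eps R i j :
  linear g ->
  iter k (opF eps) (fun i j => g (R i j)) i j = g (iter k (opF eps) R i j).
Proof.
by move=> lg; elim: k i j => //= k IH i j; rewrite !opFE !IH (linD _ _ lg) (linZ _ _ lg).
Qed.

Lemma iter_opF_shift (K : numFieldType) (W : lmodType K) k eps
    (R : int -> int -> W) (t : int) i j :
  iter k (opF eps) (fun i j => R i (j + t)) i j = iter k (opF eps) R i (j + t).
Proof.
elim: k i j => //= k IH i j; rewrite !opFE !IH.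
by have -> : j - 1 + t = j + t - 1 by lia.
Qed.

Section ThreeVariableLimits.
Variables (K : numFieldType) (W : lmodType K) (p : nat) (omega : K).
Hypotheses (p_gt0 : (0 < p)%N) (omega_p : omega ^+ p = 1).
Implicit Types (F : int -> int -> int -> W) (E : int -> int -> int -> W).
Implicit Types (a b c i j h s : int) (eps : K).

(* x2 -> omega^s (x3 + x0), the coefficient of x0^j being lim23 s F j. *)
Definition lim23 s F j a c : W := limit_coef p omega s (F a) j c.
(* x1 -> x2 + x0 *)
Definition lim12 F i b c : W := limit_coef p omega 0 (fun a b => F a b c) i b.

Definition fin23 F := forall a, fin_diag (F a).
Definition fin12 F := forall c, fin_diag (fun a b => F a b c).

Let fin_sub (G H : int -> int -> W) : fin_diag G -> fin_diag H ->
  fin_diag (fun a b => G a b - H a b).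
Proof.
move=> Gf Hf; apply: (fin_diag_sub (fin_diagD Gf (fin_diagZ (-1) Hf))) => a b <-.
by rewrite scaleN1r.
Qed.

Let limitB s (G H : int -> int -> W) i c : fin_diag G -> fin_diag H ->
  limit_coef p omega s (fun a b => G a b - H a b) i c =
  limit_coef p omega s G i c - limit_coef p omega s H i c.
Proof.
move=> Gf Hf; rewrite -scaleN1r -limitZ -limitD //; last exact: fin_diagZ.
by apply: eq_limit => a b; rewrite scaleN1r.
Qed.

Lemma fin23_dif12 F : fin23 F -> fin23 (dif12 p F).
Proof. by move=> Ff a; apply: fin_sub; [|apply: (@fin_diag_x1 _ _ p (F a))]. Qed.

Lemma fin23_dif13 F : fin23 F -> fin23 (dif13 p F).
Proof. by move=> Ff a; apply: fin_sub; [|apply: (@fin_diag_x2 _ _ p (F a))]. Qed.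

Lemma fin12_dif13 F : fin12 F -> fin12 (dif13 p F).
Proof.
by move=> Ff c; apply: fin_sub; [apply: (@fin_diag_x1 _ _ p (fun a b => F a b c))|].
Qed.

Lemma fin12_dif23 F : fin12 F -> fin12 (dif23 p F).
Proof.
by move=> Ff c; apply: fin_sub; [apply: (@fin_diag_x2 _ _ p (fun a b => F a b c))|].
Qed.

(** Here x1 - x2 becomes (x1 - x3) - x0; in [lim12_dif13] below, x1 - x3 becomes (x2 - x3) + x0. The
    other two factors merely rename a variable. *)
Lemma lim23_dif12 s F : fin23 F -> lim23 s (dif12 p F) = opS p (-1) (lim23 s F).
Proof.
move=> Ff; apply/funext => j; apply/funext => a; apply/funext => c.
rewrite /lim23 /dif12 limitB //; last exact: (@fin_diag_x1 _ _ p (F a)).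
by rewrite limit_x1 // opSE difE scaleN1r opprD addrA.
Qed.

Lemma lim23_dif13 s F : fin23 F -> lim23 s (dif13 p F) = difF p (lim23 s F).
Proof.
move=> Ff; apply/funext => j; apply/funext => a; apply/funext => c.
rewrite /lim23 /dif13 limitB //; last exact: (@fin_diag_x2 _ _ p (F a)).
by rewrite limit_x2.
Qed.

Lemma lim12_dif13 F : fin12 F -> lim12 (dif13 p F) = opS p 1 (lim12 F).
Proof.
move=> Ff; apply/funext => i; apply/funext => b; apply/funext => c.
rewrite /lim12 /dif13 limitB //; last exact: (@fin_diag_x1 _ _ p (fun a b => F a b c)).
by rewrite (@limit_x1 _ _ _ _ _ _ _ (fun a b => F a b c)) // opSE difE scale1r addrAC.
Qed.

Lemma lim12_dif23 F : fin12 F -> lim12 (dif23 p F) = difF p (lim12 F).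
Proof.
move=> Ff; apply/funext => i; apply/funext => b; apply/funext => c.
rewrite /lim12 /dif23 /dif limitB //; last exact: (@fin_diag_x2 _ _ p (fun a b => F a b c)).
by rewrite (@limit_x2 _ _ _ _ _ (fun a b => F a b c)).
Qed.

(** The second limit turns the difference of the two remaining variables into a new formal variable,
    so [opS] becomes [opF]. Finiteness is asked only up to [J] because [opS] never looks at higher
    coefficients. *)
Lemma limit_opS s k eps E e (J : int) : (forall j, j <= J -> fin_diag (E j)) ->
  forall j, j <= J -> fin_diag (iter k (opS p eps) E j) /\ forall h,
  limit_coef p omega s (iter k (opS p eps) E j) h e =
  iter k (opF eps) (fun j h => limit_coef p omega s (E j) h e) j h.
Proof.
move=> Ef; elim: k => [|k IH] j jJ /=; first by split=> //; apply: Ef.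
have j1 : j - 1 <= J by lia.
have [f0 l0] := IH j jJ; have [f1 l1] := IH _ j1.
have f0' := fin_diag_dif p f0; have f1' := fin_diagZ eps f1; split.
  exact: fin_diagD.
by move=> h; rewrite !opFE limitD // limitZ limit_dif // l0 l1.
Qed.

End ThreeVariableLimits.

(** * Weak commutativity and modified weak associativity *)

Section WeakCommutativity.
Variables (K : numFieldType) (M : lmodType K) (p : nat).
Variables (V : Type) (A : V -> int -> M -> M).
Local Notation Y := (fcoef p A).

Definition ser2 (u v : V) (w : M) (a b : int) : M := Y u a (Y v b w).
Definition comm_ser (u v : V) (w : M) (a b : int) : M :=
  ser2 u v w a b - Y v b (Y u a w).

(** Passing from (x2 - x1)^k to (x1 - x2)^k costs the same sign on both sides. *)
Lemma weak_commutativityP u v k : weak_commutativity p A u v k <->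
  forall w a b, iter k (dif p) (comm_ser u v w) a b = 0.
Proof.
have E w a b : iter k (dif p) (comm_ser u v w) a b =
    iter k (dif p) (ser2 u v w) a b -
    (-1) ^+ k *: iter k (dif p) (fun b a => Y v b (Y u a w)) b a.
  rewrite iter_difB; congr (_ - _).
  rewrite (iter_dif_flip p k (fun a b => Y v b (Y u a w)) a b) scalerA.
  by rewrite -expr2 sqrr_sign scale1r.
have F w a b : iter k (dif p) (fun b a => Y u a (Y v b w)) b a =
    (-1) ^+ k *: iter k (dif p) (ser2 u v w) a b.
  exact: (iter_dif_flip p k (ser2 u v w) a b).
rewrite /weak_commutativity; split=> H w a b.
  rewrite E; have := H w a b; rewrite !binom_mulE F => ->.
  by rewrite scalerA -expr2 sqrr_sign scale1r subrr.
rewrite !binom_mulE F; have /eqP := H w a b; rewrite E subr_eq0 => /eqP ->.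
by rewrite scalerA -expr2 sqrr_sign scale1r.
Qed.

Lemma weak_commutativity_sym u v k :
  weak_commutativity p A u v k -> weak_commutativity p A v u k.
Proof.
move=> /weak_commutativityP H; apply/weak_commutativityP => w a b.
have -> : comm_ser v u w = fun a b => (-1) *: comm_ser u v w b a.
  by do 2 apply/funext => ?; rewrite scaleN1r opprB.
rewrite (iter_dif_lin _ _ (h := fun x => -1 *: x)); last first.
  by move=> k' x y; rewrite scalerDr !scalerA mulrC.
by rewrite (iter_dif_flip p k (comm_ser u v w) b a) H !scaler0.
Qed.

Lemma weak_commutativity_up u v k l : (k <= l)%N ->
  weak_commutativity p A u v k -> weak_commutativity p A u v l.
Proof.
move=> kl /weak_commutativityP H; apply/weak_commutativityP => w a b.
rewrite -(subnK kl) iterD; exact: iter_dif0.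
Qed.

Hypothesis A_trunc :
  forall v w, exists N : int, forall j, N <= j -> A v j w = 0.

Lemma fcoef_low v w : exists N : int, forall e, e < N -> Y v e w = 0.
Proof.
have [N HN] := A_trunc v w; exists (- N - p%:Z) => e eN.
by apply: HN; lia.
Qed.

Hypothesis A_linear : forall v j, linear (A v j).

Lemma fcoef_linear v e : linear (Y v e).
Proof. exact: A_linear. Qed.

(** Each order of the product is bounded below in the variable of the operator acting first on [w].
    After multiplication by (x1 - x2)^k the two orders agree, so both variables are bounded. *)
Lemma ser2_dif_fin u v k w : weak_commutativity p A u v k ->
  fin_diag (iter k (dif p) (ser2 u v w)).
Proof.
move=> /weak_commutativityP H.
have [N HN] := fcoef_low u w; have [N' HN'] := fcoef_low v w.
apply: (@fin_diag_low _ _ _ N N').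
  have E a b : iter k (dif p) (ser2 u v w) a b =
               iter k (dif p) (fun a b => Y v b (Y u a w)) a b.
    by apply/eqP; rewrite -subr_eq0 -iter_difB; apply/eqP; apply: H.
  move=> a b aN; rewrite E; move: a b aN; apply: iter_dif_low1 => a b aN.
  by rewrite HN // lin0 //; apply: fcoef_linear.
apply: iter_dif_low2 => a b bN.
by rewrite /ser2 HN' // lin0 //; apply: fcoef_linear.
Qed.

End WeakCommutativity.

Section WeakCommutativityLinear.
Variables (K : numFieldType) (M V : lmodType K) (p : nat).
Variables (A : V -> int -> M -> M).
Hypothesis A_linearl : forall j w, linear (fun v => A v j w).
Hypothesis A_linearr : forall v j, linear (A v j).

Lemma weak_commutativity0 u k : weak_commutativity p A u 0 k.
Proof.
apply/weak_commutativityP => w a b; apply: iter_dif0 => {}a {}b.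
have z j x : A 0 j x = 0 by exact: (lin0 (A_linearl j x)).
by rewrite /comm_ser /ser2 /fcoef !z (lin0 (A_linearr _ _)) subr0.
Qed.

Lemma weak_commutativity_lin u c v v' k : weak_commutativity p A u v k ->
  weak_commutativity p A u v' k -> weak_commutativity p A u (c *: v + v') k.
Proof.
move=> /weak_commutativityP H /weak_commutativityP H'.
apply/weak_commutativityP => w a b.
have -> : comm_ser p A u (c *: v + v') w =
    fun a b => c *: comm_ser p A u v w a b + comm_ser p A u v' w a b.
  do 2 apply/funext => ?; rewrite /comm_ser /ser2 /fcoef !A_linearl A_linearr.
  by rewrite scalerBr opprD addrACA.
rewrite iter_difD H' addr0 (iter_dif_lin _ _ (h := fun x => c *: x)).
  by rewrite H scaler0.
by move=> k' x y; rewrite scalerDr !scalerA mulrC.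
Qed.

End WeakCommutativityLinear.

Section Modules.
Variables (K : numFieldType) (V : lmodType K) (X : voa V).
Variables (M : lmodType K) (p : nat) (omega : K) (nu : voa_aut X).
Variable YM : V -> int -> M -> M.
Hypotheses (p_gt0 : (0 < p)%N) (omega_p : omega ^+ p = 1).
Hypothesis YM_linearl : forall j w, linear (fun v => YM v j w).
Hypothesis YM_linearr : forall v j, linear (YM v j).
Hypothesis YM_trunc :
  forall v w, exists N : int, forall j, N <= j -> YM v j w = 0.

Local Notation Y := (fcoef p YM).

(** Isolating one s lets the exponent depend on s until [assoc_at_comm] replaces it by that of weak
    commutativity. *)
Definition assoc_at (s : int) (u v : V) (k : nat) : Prop :=
  forall w, fin_diag (iter k (dif p) (ser2 p YM u v w)) /\ forall i c,
  limit_coef p omega s (iter k (dif p) (ser2 p YM u v w)) i c =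
  Y (vmode X (aut_pow nu (- s) u) (k%:Z - 1 - i) v) c w.

Lemma modified_weak_associativityP u v k :
  modified_weak_associativity p omega nu YM u v k <->
  forall s, assoc_at s u v k.
Proof.
have E w : binom_mul p k (fun a b => Y u a (Y v b w)) =
           iter k (dif p) (ser2 p YM u v w) by rewrite binom_mulE.
have E2 i : - (i - k%:Z) - 1%N%:Z = k%:Z - 1 - i by lia.
split=> H s w; have := H s w; rewrite E => -[fin eqn]; split.
- exact: (proj1 (limit_definedP p_gt0 omega_p s _) fin).
- by move=> i c; rewrite eqn {2}/fcoef E2.
- exact: (proj2 (limit_definedP p_gt0 omega_p s _) fin).
by move=> i c; rewrite eqn {3}/fcoef E2.
Qed.

(** Extra factors x1 - x2 only shift the power of x0, so the limits for k and k' are both read off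
    the exponent k + k'. The exponent matters for the existence of the limit alone. *)
Lemma assoc_at_exponent s u v k k' : assoc_at s u v k' ->
  (forall w, fin_diag (iter k (dif p) (ser2 p YM u v w))) -> assoc_at s u v k.
Proof.
move=> H fink w; split=> // i c; have [fink' E] := H w.
have -> : i = i + k'%:Z - k'%:Z by lia.
rewrite -limit_iter_dif // -iterD addnC iterD.
rewrite limit_iter_dif // E; congr (Y (vmode _ _ _ _) _ _); lia.
Qed.

Lemma assoc_at_up s u v k l : (k <= l)%N -> assoc_at s u v k -> assoc_at s u v l.
Proof.
move=> kl H; apply: (assoc_at_exponent H) => w.
by rewrite -(subnK kl) iterD; apply: fin_diag_iter_dif; have [] := H w.
Qed.

Lemma assoc_at_comm s u v k k' : assoc_at s u v k' ->
  weak_commutativity p YM u v k -> assoc_at s u v k.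
Proof.
move=> H C; apply: (assoc_at_exponent H) => w; exact: ser2_dif_fin.
Qed.

(* Substituting x1 -> x2 + x0 in (x3 - x1)^k1 (x3 - x2)^k2 (x1 - x2)^k'
   [Y(w, x3), Y(u, x1) Y(v, x2)] = 0 gives
   (x3 - x2 - x0)^k1 (x3 - x2)^k2 [Y(w, x3), Y(Y(u, x0) v, x2)] = 0, and the
   coefficients of the powers of x0 are annihilated one after the other. *)
Lemma weak_commutativity_mode u v w k1 k2 k' (n0 : int) m :
  assoc_at 0 u v k' -> (forall n, n0 < n -> vmode X u n v = 0) ->
  weak_commutativity p YM w u k1 -> weak_commutativity p YM w v k2 ->
  weak_commutativity p YM w (vmode X u (n0 - m%:Z) v) (k1 + k2 + m).
Proof.
move=> uv n0P /weak_commutativityP wu /weak_commutativityP wv.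
apply/weak_commutativityP => z.
have Ylin x e : linear (Y x e) by exact: fcoef_linear.
(* In the numbering of [dif12], [w] carries the first variable, [u] the second and [v] the third.
   The commutator with a product obeys the Leibniz rule, T = T1 + T2, and each part is killed by one
   of the two powers. *)
pose T1 a b c := comm_ser p YM w u (Y v c z) a b.
pose T2 a b c := Y u b (comm_ser p YM w v z a c).
pose T a b c := Y w a (ser2 p YM u v z b c) - ser2 p YM u v (Y w a z) b c.
have TE : T = fun a b c => T1 a b c + T2 a b c.
  do 3 apply/funext => ?; rewrite /T1 /T2 /T /comm_ser /ser2.
  by rewrite (linB _ _ (Ylin _ _)) addrA subrK.
have T0 a b c : iter k1 (dif12 p) (iter k2 (dif13 p) T) a b c = 0.
  have D12 : iter k1 (dif12 p) T1 = fun _ _ _ => 0.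
    by do 3 apply/funext => ?; rewrite iter_dif12E wu.
  have D13 : iter k2 (dif13 p) T2 = fun _ _ _ => 0.
    do 3 apply/funext => ?; rewrite iter_dif13E.
    by rewrite (iter_dif_lin _ _ (h := Y u _)) // wv (lin0 (Ylin _ _)).
  have -> : iter k2 (dif13 p) T = fun a b c => iter k2 (dif13 p) T1 a b c.
    do 3 apply/funext => ?; rewrite TE iter_dif13E iter_difD -!iter_dif13E.
    by rewrite D13 addr0.
  rewrite -/(iter k2 (dif13 p) T1) (iter_comm _ _ _ (@dif12_13 _ _ _)) D12.
  by rewrite iter_dif13E; apply: iter_dif0.
have Yfin x := (uv x).1; have Yeq x := (uv x).2.
pose F := iter k' (dif23 p) T.
have FE a : F a = fun b c => Y w a (iter k' (dif p) (ser2 p YM u v z) b c) -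
                  iter k' (dif p) (ser2 p YM u v (Y w a z)) b c.
  do 2 apply/funext => ?; rewrite /F iter_dif23E iter_difB.
  by rewrite (iter_dif_lin _ _ (h := Y w _)).
have G1 a : fin_diag (fun b c => Y w a (iter k' (dif p) (ser2 p YM u v z) b c)).
  by apply: (fin_diag_sub (Yfin z)) => b c ->; apply: lin0.
have Ffin : fin23 F.
  move=> a; rewrite FE.
  apply: (fin_diag_sub (fin_diagD (G1 a) (fin_diagZ (-1) (Yfin (Y w a z))))).
  by move=> b c <-; rewrite scaleN1r.
have LE j : lim23 p omega 0 F j =
    comm_ser p YM w (vmode X u (k'%:Z - 1 - j) v) z.
  apply/funext => a; apply/funext => c; rewrite /lim23 FE.
  transitivity (limit_coef p omega 0
     (fun b c => Y w a (iter k' (dif p) (ser2 p YM u v z) b c) +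
       -1 *: iter k' (dif p) (ser2 p YM u v (Y w a z)) b c) j c).
    by apply: eq_limit => ? ?; rewrite scaleN1r.
  rewrite limitD // ?limitZ ?limit_lin // ?Yeq ?scaleN1r //.
  exact/fin_diagZ.
pose E j := iter k2 (dif p) (lim23 p omega 0 F j).
(* The coefficient of x0^j belongs to the mode k' - 1 - j of [u], so the series starts at j = k' - 1
   - n0, and m steps higher sits the mode n0 - m. *)
have E0 j a c : j < k'%:Z - 1 - n0 -> E j a c = 0.
  move=> jn; apply: iter_dif0 => {}a {}c; rewrite LE n0P; last by lia.
  have z0 i x : YM 0 i x = 0 by exact: (lin0 (YM_linearl i x)).
  by rewrite /comm_ser /ser2 /fcoef !z0 (lin0 (YM_linearr _ _)) subr0.
have [F2fin LE2] := iter_morph k2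
   (@fin23_dif13 _ _ p) (lim23_dif13 p_gt0 omega_p 0) Ffin.
have [_ LE1] := iter_morph k1
   (@fin23_dif12 _ _ p) (lim23_dif12 p_gt0 omega_p 0) F2fin.
have opE0 j a c : iter k1 (opS p (-1)) E j a c = 0.
  have -> : E = iter k2 (difF p) (lim23 p omega 0 F).
    by apply/funext => i; rewrite iter_difFE.
  rewrite -LE2 -LE1 /F !(iter_comm _ _ _ (@dif13_23 _ _ _)).
  rewrite (iter_comm _ _ _ (@dif12_23 _ _ _)).
  rewrite /lim23 (eq_limit _ _ _ (G := fun _ _ => 0)) ?limit0 //.
  by move=> b c'; rewrite iter_dif23E; apply: iter_dif0.
move=> a c; have := opS_vanish E0 opE0 m a c.
rewrite /E -iterD LE -addnA [(m + _)%N]addnC addnA.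
by have -> : k'%:Z - 1 - (k'%:Z - 1 - n0 + m%:Z) = n0 - m%:Z by lia.
Qed.

End Modules.

(** * Composition of formal limits *)

Section CompositeLimits.
Variables (K : numFieldType) (W : lmodType K) (p : nat) (omega : K).
Hypotheses (p_gt0 : (0 < p)%N) (omega_p : omega ^+ p = 1).

Lemma tsum_seq2 (T T' : choiceType) (r : seq T) (r' : seq T') (f : T -> T' -> W) :
  uniq r -> uniq r' -> (forall a b, f a b != 0 -> (a \in r) && (b \in r')) ->
  tsum (fun a => tsum (f a)) = \sum_(a <- r) \sum_(b <- r') f a b.
Proof.
move=> ur ur' fr.
have E a : tsum (f a) = \sum_(b <- r') f a b.
  by rewrite (tsum_seq (r := r')) // => b /fr /andP[].
rewrite (eq_tsum E) (tsum_seq (r := r)) // => a.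
apply: contraNT => ar; rewrite big1 // => b _.
by apply/eqP; apply: contraNT ar => /fr /andP[].
Qed.

Lemma omega_shift_mul s a n : omega ^ (s * (a + (p * n)%N%:Z)) = omega ^ (s * a).
Proof.
elim: n => [|n IH]; first by rewrite muln0 addr0.
rewrite -IH -[in RHS](omega_shift p_gt0 omega_p).
by congr (_ ^ (_ * _)); rewrite mulnS PoszD; lia.
Qed.

(* Substituting x1 -> x2 + y, then x2 -> omega^s (x3 + x0), amounts to
   x2 -> omega^s (x3 + x0), then x1 -> omega^s (x3 + z), then z -> x0 + y. *)
Lemma limit_lim12 (F : int -> int -> int -> W) (N : int) (s e : int) (i j : nat) :
  (forall a b c, [|| a < N, b < N | c < N] -> F a b c = 0) ->
  limit_coef p omega s (lim12 p omega F i) j e =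
  \sum_(l < j.+1) ('C(i + l, i)%:R : K) *:
     limit_coef p omega s (lim23 p omega s F (j - l)%N) (i + l)%N e.
Proof.
(* Both substitutions preserve the total degree, so only exponents of F with sum [B] contribute and
   two indices suffice. *)
move=> FN; pose B := e + (p * (i + j))%N%:Z.
pose H a b := F a b (B - a - b).
pose r := undup (int_range N (B - N - N)).
have Hr a b : H a b != 0 -> (a \in r) && (b \in r).
  move=> Hab; rewrite !mem_undup; apply/andP.
  have : ~~ [|| a < N, b < N | B - a - b < N].
    by apply: contraNN Hab => /FN; rewrite /H => ->.
  by rewrite !negb_or -!leNgt => /and3P[aN bN cN]; split; apply: mem_int_range; lia.
have p0 : (p%:R : K) != 0 by rewrite pnatr_eq0 -lt0n.
pose q a : K := a%:~R / p%:R.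
pose z a : K := omega ^ (s * a).
have zD a b : z (a + b) = z a * z b.
  by rewrite /z mulrDr expfzDr // (omega_neq0 p_gt0 omega_p).
pose f a2 a1 := (z a2 * gbinom (q a2) j * gbinom (q a1) i) *: H a1 (a2 + (p * i)%N%:Z - a1).
transitivity (tsum (fun a2 => tsum (f a2))).
  apply: eq_tsum => a2; rewrite /limit_term -tsumZ; apply: eq_tsum => a1.
  rewrite /limit_term mul0r expr0z mul1r scalerA; congr (_ *: F _ _ _).
  by rewrite /B mulnDr PoszD; lia.
rewrite (tsum_exchange (r := int_range (N + N - (p * i)%N%:Z)
                              (B - N - (p * i)%N%:Z)) (r' := r)); last first.
  move=> a2 a1; rewrite /f scaler_eq0 negb_or => /andP[_] H0.
  have := Hr _ _ H0 => /andP[-> _]; rewrite andbT.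
  have : ~~ [|| a1 < N, a2 + (p * i)%N%:Z - a1 < N
             | B - a1 - (a2 + (p * i)%N%:Z - a1) < N].
    by apply: contraNN H0 => /FN; rewrite /H => ->.
  by rewrite !negb_or -!leNgt => /and3P[aN bN cN]; apply: mem_int_range; lia.
pose g l a b : W := (z a * z b * gbinom (q a) (i + l) * 'C(i + l, i)%:R *
                 gbinom (q b) (j - l)) *: H a b.
(* With a2 = a + b - p i, Vandermonde splits binom(a/p - i + b/p, j) into a share l coming from x1
   and a share j - l coming from x2; [gbinom_revision] merges the first with binom(a/p, i). *)
transitivity (tsum (fun a => tsum (fun b => \sum_(l < j.+1) g l a b))).
  apply: eq_tsum => a; rewrite -(tsum_shift _ (a - (p * i)%N%:Z)).
  apply: eq_tsum => b; rewrite /f.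
  have -> : b + (a - (p * i)%N%:Z) + (p * i)%N%:Z - a = b by lia.
  rewrite -scaler_suml; congr (_ *: _).
  have -> : q (b + (a - (p * i)%N%:Z)) = (q a - i%:R) + q b.
    by rewrite /q !intrD intrN -pmulrn natrM; field.
  have -> : z (b + (a - (p * i)%N%:Z)) = z a * z b.
    rewrite -zD /z -(omega_shift_mul s (b + _) i).
    by congr (_ ^ (_ * _)); lia.
  rewrite vandermonde mulr_sumr mulr_suml; apply: eq_bigr => l _.
  by rewrite -(mulrA _ (gbinom (q a) (i + l))) gbinom_revision; ring.
rewrite (tsum_seq2 (r := r) (r' := r)) ?undup_uniq //; last first.
  move=> a b; apply: contraNT => /(contraNT (Hr a b)) /eqP H0.
  by rewrite big1 // => l _; rewrite /g H0 scaler0.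
under eq_bigr do rewrite exchange_big.
rewrite exchange_big; apply: eq_bigr => l _ /=.
rewrite -(tsum_seq2 (r := r) (r' := r)) ?undup_uniq //; last first.
  by move=> a b; rewrite /g scaler_eq0 negb_or => /andP[_]; apply: Hr.
rewrite -tsumZ; apply: eq_tsum => a; rewrite /limit_term -!tsumZ.
apply: eq_tsum => b; rewrite /limit_term /g !scalerA; congr (_ *: F _ _ _).
  by rewrite -/(q a) -/(q b) -/(z a) -/(z b); ring.
have lj : (l <= j)%N by rewrite -ltnS.
by rewrite /B -{1}(subnK lj) !mulnDr !PoszD; lia.
Qed.

End CompositeLimits.

(** * Products of three vertex operators *)

Section ThreeVariableBounds.
Variables (K : numFieldType) (W : lmodType K) (p : nat).
Implicit Types F : int -> int -> int -> W.

Definition down_closed (Q : int -> int -> int -> bool) : Prop := forall a b c,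
  Q a b c -> [/\ Q (a - p%:Z) b c, Q a (b - p%:Z) c & Q a b (c - p%:Z)].

Lemma iter_dif_low3 k (Q : int -> int -> int -> bool) F : down_closed Q ->
  (forall a b c, Q a b c -> F a b c = 0) -> forall a b c, Q a b c ->
  [/\ iter k (dif12 p) F a b c = 0, iter k (dif13 p) F a b c = 0
    & iter k (dif23 p) F a b c = 0].
Proof.
move=> Qd F0; elim: k => [|k IH] a b c Qabc; first by split; apply: F0.
have [Q1 Q2 Q3] := Qd _ _ _ Qabc.
have [D1 D2 D3] := IH _ _ _ Q1; have [E1 E2 E3] := IH _ _ _ Q2.
have [G1 G2 G3] := IH _ _ _ Q3.
rewrite /= {1}/dif12 {1}/dif13 {1}/dif23 difE.
by rewrite D1 E1 D2 G2 E3 G3 subrr.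
Qed.

Lemma opS_difF eps (E : int -> int -> int -> W) :
  opS p eps (difF p E) = difF p (opS p eps E).
Proof.
apply/funext => j; apply/funext => a; apply/funext => c.
rewrite opSE /difF [RHS]difE !opSE [X in X + _ = _]difE.
rewrite [X in _ + _ *: X = _]difE scalerBr.
by rewrite [in RHS]opprD addrACA.
Qed.

End ThreeVariableBounds.

Section Theta.
Variables (K : numFieldType) (V : lmodType K) (X : voa V).

(* The coefficient of y^i x0^j in
   (z - x0)^k z^k x0^g Y(w, z) Y(u, x0) v after z -> x0 + y. *)
Definition theta (k g i j : nat) (w u v : V) : V :=
  \sum_(l < j.+1) ('C(i + l, i)%:R : K) *:
    iter k (opF (-1))
      (fun j h => vmode X w (k%:Z - 1 - h) (vmode X u (g%:Z - 1 - j) v))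
      (j - l)%N (i + l)%N.

Variables (M : lmodType K) (p : nat) (omega : K) (nu : voa_aut X).
Variable YM : V -> int -> M -> M.
Hypotheses (p_gt0 : (0 < p)%N) (omega_p : omega ^+ p = 1).
Hypothesis YM_linearl : forall j w, linear (fun v => YM v j w).
Hypothesis YM_linearr : forall v j, linear (YM v j).
Hypothesis YM_trunc :
  forall v w, exists N : int, forall j, N <= j -> YM v j w = 0.

Local Notation Y := (fcoef p YM).
Local Notation wc := (weak_commutativity p YM).
Local Notation assoc := (assoc_at p omega nu YM).

(** On the left, x1 -> x2 + y carries no root of unity, so [w] and [u] need associativity at s = 0
    only, and [opF 1] is the factor (x1 - x3)^k turned into (x0 + y)^k. On the right, omega^s enters
    both substitutions, which twists [w] and [u] alike. *)
Lemma theta_formula (w u v : V) (s : int) (k g i j : nat) (z : M) (e : int) :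
  wc w u k -> wc w v k -> wc u v k -> (k <= g)%N ->
  assoc 0 w u k -> assoc s u v g ->
  (forall J : int, exists t, forall j' : int, j' <= J ->
     assoc s w (vmode X (aut_pow nu (- s) u) (g%:Z - 1 - j') v) t) ->
  (forall i' : int, i' <= i%:Z ->
     fin_diag (iter g (dif p) (ser2 p YM (vmode X w (k%:Z - 1 - i') u) v z))) ->
  iter k (opF 1) (fun i j => limit_coef p omega s
     (iter g (dif p) (ser2 p YM (vmode X w (k%:Z - 1 - i) u) v z)) j e) i j
  = Y (theta k g i j (aut_pow nu (- s) w) (aut_pow nu (- s) u) v) e z.
Proof.
move=> wu wv uv kg a0wu asuv aswB finP.
have Ylin x a : linear (Y x a) by exact: fcoef_linear.
have Ylinl a x : linear (fun y => Y y a x) by exact: YM_linearl.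
pose T a b c := Y w a (Y u b (Y v c z)).
pose F := iter k (dif12 p) (iter k (dif13 p) (iter g (dif23 p) T)).
pose F0 := iter k (dif12 p) T.
pose P i := ser2 p YM (vmode X w (k%:Z - 1 - i) u) v z.
have F0E c : (fun a b => F0 a b c) = iter k (dif p) (ser2 p YM w u (Y v c z)).
  by do 2 apply/funext => ?; rewrite /F0 iter_dif12E.
have F0fin : fin12 F0 by move=> c; rewrite F0E; have [] := a0wu (Y v c z).
have L0 : lim12 p omega F0 = P.
  apply/funext => n; apply/funext => b; apply/funext => c; rewrite /lim12 F0E.
  by have [_ ->] := a0wu (Y v c z).
have FF0 : F = iter k (dif13 p) (iter g (dif23 p) F0).
  rewrite /F /F0 (iter_comm _ _ _ (@dif12_13 _ _ p)).
  by rewrite (iter_comm _ _ _ (@dif12_23 _ _ p)).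
have [F1fin L1] := iter_morph g
   (@fin12_dif23 _ _ p) (lim12_dif23 p_gt0 omega_p) F0fin.
have [_ L2] := iter_morph k
   (@fin12_dif13 _ _ p) (lim12_dif13 p_gt0 omega_p) F1fin.
have L12F : lim12 p omega F = iter k (opS p 1) (iter g (difF p) P).
  by rewrite FF0 L2 L1 L0.
pose B j := vmode X (aut_pow nu (- s) u) (g%:Z - 1 - j) v.
pose P2 j := ser2 p YM w (B j) z.
pose G0 := iter g (dif23 p) T.
have G0E a : G0 a = fun b c => Y w a (iter g (dif p) (ser2 p YM u v z) b c).
  do 2 apply/funext => ?; rewrite /G0 iter_dif23E.
  by rewrite -(iter_dif_lin p g (ser2 p YM u v z)).
have [asfin aseq] := asuv z.
have G0fin : fin23 G0.
  by move=> a; rewrite G0E; apply: (fin_diag_sub asfin) => b c ->; apply: lin0.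
have L3 : lim23 p omega s G0 = P2.
  apply/funext => n; apply/funext => a; apply/funext => c.
  by rewrite /lim23 G0E limit_lin // aseq.
have [F2fin L4] := iter_morph k
   (@fin23_dif13 _ _ p) (lim23_dif13 p_gt0 omega_p s) G0fin.
have [F3fin L5] := iter_morph k
   (@fin23_dif12 _ _ p) (lim23_dif12 p_gt0 omega_p s) F2fin.
have L23F : lim23 p omega s F = iter k (opS p (-1)) (iter k (difF p) P2).
  by rewrite /F L5 L4 L3.
(* Each variable is bounded by moving its operator next to [z]: [w] passes [u] and [v] thanks to (x1
   - x2)^k and (x1 - x3)^k, [u] passes [v] thanks to (x2 - x3)^g, and [v] is already there. *)
have [N [FN1 FN2 FN3]] : exists N : int, [/\ forall a b c, a < N -> F a b c = 0,
    forall a b c, b < N -> F a b c = 0 & forall a b c, c < N -> F a b c = 0].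
  have [N1 HN1] := fcoef_low p YM_trunc w z.
  have [N2 HN2] := fcoef_low p YM_trunc u z.
  have [N3 HN3] := fcoef_low p YM_trunc v z.
  pose N := Num.min N1 (Num.min N2 N3); exists N.
  have NN1 a : a < N -> a < N1 by rewrite /N !lt_min => /and3P[].
  have NN2 a : a < N -> a < N2 by rewrite /N !lt_min => /and3P[].
  have NN3 a : a < N -> a < N3 by rewrite /N !lt_min => /and3P[].
  pose Q1 (a b c : int) := a < N; pose Q2 (a b c : int) := b < N.
  pose Q3 (a b c : int) := c < N.
  have Qd1 : down_closed p Q1 by rewrite /down_closed /Q1 => a b c ?; split; lia.
  have Qd2 : down_closed p Q2 by rewrite /down_closed /Q2 => a b c ?; split; lia.
  have Qd3 : down_closed p Q3 by rewrite /down_closed /Q3 => a b c ?; split; lia.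
  have K12 Q (G : int -> int -> int -> M) n : down_closed p Q ->
      (forall a b c, Q a b c -> G a b c = 0) ->
      forall a b c, Q a b c -> iter n (dif12 p) G a b c = 0.
    by move=> Qd H0 a b c /(iter_dif_low3 n Qd H0) [].
  have K13 Q (G : int -> int -> int -> M) n : down_closed p Q ->
      (forall a b c, Q a b c -> G a b c = 0) ->
      forall a b c, Q a b c -> iter n (dif13 p) G a b c = 0.
    by move=> Qd H0 a b c /(iter_dif_low3 n Qd H0) [].
  have K23 Q (G : int -> int -> int -> M) n : down_closed p Q ->
      (forall a b c, Q a b c -> G a b c = 0) ->
      forall a b c, Q a b c -> iter n (dif23 p) G a b c = 0.
    by move=> Qd H0 a b c /(iter_dif_low3 n Qd H0) [].
  have eq_dif n (G G' : int -> int -> M) :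
      (forall a b, iter n (dif p) (fun a b => G a b - G' a b) a b = 0) ->
      forall a b, iter n (dif p) G a b = iter n (dif p) G' a b.
    by move=> H0 a b; apply/eqP; rewrite -subr_eq0 -iter_difB H0.
  split.
  - pose T1 a b c := Y u b (Y w a (Y v c z)).
    pose T1' a b c := Y u b (Y v c (Y w a z)).
    have E1 : iter k (dif12 p) T = iter k (dif12 p) T1.
      apply/funext => a; apply/funext => b; apply/funext => c.
      rewrite !iter_dif12E; apply: eq_dif => {}a {}b.
      by have /weak_commutativityP := wu; apply.
    have E2 : iter k (dif13 p) T1 = iter k (dif13 p) T1'.
      apply/funext => a; apply/funext => b; apply/funext => c.
      rewrite !iter_dif13E; apply: eq_dif => {}a {}c.
      have -> : (fun a b0 => T1 a b b0 - T1' a b b0) =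
                fun a c => Y u b (comm_ser p YM w v z a c).
        by do 2 apply/funext => ?; rewrite (linB _ _ (Ylin u b)).
      rewrite (iter_dif_lin _ _ (h := Y u b)) //.
      by have /weak_commutativityP -> := wv; rewrite lin0.
    have -> : F = iter g (dif23 p) (iter k (dif12 p) (iter k (dif13 p) T1')).
      rewrite -E2 (iter_comm k k T1 (@dif12_13 _ _ p)) -E1.
      rewrite -(iter_comm k k T (@dif12_13 _ _ p)).
      by rewrite -(iter_comm _ _ _ (@dif12_23 _ _ p)) -(iter_comm k g T (@dif13_23 _ _ p)).
    rewrite -[forall a b c, _]/(forall a b c, Q1 a b c -> _).
    apply: (K23 Q1) => //; apply: (K12 Q1) => //; apply: (K13 Q1) => // a b c aN.
    by rewrite /T1' (HN1 a) ?NN1 // (lin0 (Ylin v c)) (lin0 (Ylin u b)).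
  - pose T2 a b c := Y w a (Y v c (Y u b z)).
    have E1 : iter g (dif23 p) T = iter g (dif23 p) T2.
      apply/funext => a; apply/funext => b; apply/funext => c.
      rewrite !iter_dif23E; apply: eq_dif => {}b {}c.
      have -> : (fun a0 b0 => T a a0 b0 - T2 a a0 b0) =
                fun b c => Y w a (comm_ser p YM u v z b c).
        by do 2 apply/funext => ?; rewrite (linB _ _ (Ylin w a)).
      rewrite (iter_dif_lin _ _ (h := Y w a)) //.
      have /weak_commutativityP -> := weak_commutativity_up kg uv.
      exact: lin0.
    rewrite /F E1 -[forall a b c, _]/(forall a b c, Q2 a b c -> _).
    apply: (K12 Q2) => //; apply: (K13 Q2) => //; apply: (K23 Q2) => // a b c bN.
    by rewrite /T2 (HN2 b) ?NN2 // (lin0 (Ylin v c)) (lin0 (Ylin w a)).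
  rewrite /F -[forall a b c, _]/(forall a b c, Q3 a b c -> _).
  apply: (K12 Q3) => //; apply: (K13 Q3) => //; apply: (K23 Q3) => // a b c cN.
  by rewrite /T (HN3 c) ?NN3 // (lin0 (Ylin u b)) (lin0 (Ylin w a)).
have F23low J : fin_diag (lim23 p omega s F J).
  case: J => [J|J]; last first.
    by move=> c; exists [::] => a; rewrite /lim23 limit_neg eqxx.
  apply: (@fin_diag_low _ _ _ N (N + N - (p * J)%N%:Z)) => a c lt.
    transitivity (limit_coef p omega s (fun _ _ => 0 : M) J c); last exact: limit0.
    by apply: eq_limit => ? ?; apply: FN1.
  apply: tsum0 => b; rewrite /limit_term.
  have [bN|bN] := ltP b N; first by rewrite FN2 // scaler0.
  by rewrite FN3 ?scaler0 //; lia.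
have FN a b c : [|| a < N, b < N | c < N] -> F a b c = 0.
  by move=> /or3P[/FN1|/FN2|/FN3].
have -> : (fun i j => limit_coef p omega s
     (iter g (dif p) (ser2 p YM (vmode X w (k%:Z - 1 - i) u) v z)) j e) =
   (fun i j => limit_coef p omega s (iter g (difF p) P i) j e).
  by do 2 apply/funext => ?; rewrite iter_difFE.
have finP' (i' : int) : i' <= i%:Z -> fin_diag (iter g (difF p) P i').
  by rewrite iter_difFE; apply: finP.
have [_ <-] := limit_opS p_gt0 omega_p s k 1 e finP' (lexx _).
rewrite -L12F (limit_lim12 p_gt0 omega_p _ _ _ _ FN).
rewrite /theta (lin_sum _ _ _ (Ylinl e z)).
apply: eq_bigr => l _; rewrite (linZ _ _ (Ylinl e z)); congr (_ *: _).
set J := (j - l)%N; set h := (i + l)%N.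
have [t Ht] := aswB J%:Z.
pose E2 := iter t (difF p) P2.
have E2fin (j' : int) : j' <= J%:Z -> fin_diag (E2 j').
  by move=> /Ht /(_ z) [H _]; rewrite /E2 iter_difFE.
have E2eq (j' h' : int) : j' <= J%:Z -> limit_coef p omega s (E2 j') h' e =
    Y (vmode X (aut_pow nu (- s) w) (t%:Z - 1 - h') (B j')) e z.
  by move=> /Ht /(_ z) [_ H]; rewrite /E2 iter_difFE H.
(* The products [P2 j'] are known to have a limit only after t further factors x1 - x3; these raise
   the power by t, and the shift is undone at the end. *)
rewrite -[h%:Z](addrK t%:Z) -(limit_iter_dif p_gt0 omega_p) //.
rewrite -iter_difFE L23F (iter_comm _ _ _ (fun E => esym (opS_difF p (-1) E))).
rewrite (iter_comm t k P2) // -/E2.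
have E3fin (j' : int) : j' <= J%:Z -> fin_diag (iter k (difF p) E2 j').
  by move=> /E2fin ?; rewrite iter_difFE; apply: fin_diag_iter_dif.
have [_ ->] := limit_opS p_gt0 omega_p s k (-1) e E3fin (lexx _).
pose R j' h' := Y (vmode X (aut_pow nu (- s) w) (k%:Z - 1 - h') (B j')) e z.
rewrite (@opF_eq_on _ _ _ _ _ (fun j' h' => R j' (h' - t%:Z)) J%:Z) //; last first.
  move=> j' h' jJ; rewrite iter_difFE (limit_iter_dif p_gt0 omega_p); last exact: E2fin.
  by rewrite E2eq // /R; congr (Y (vmode _ _ _ _) _ _); lia.
rewrite (iter_opF_shift k (-1) R (- t%:Z)) addrK.
exact: (iter_opF_lin _ _ (fun j' h' => vmode X _ (k%:Z - 1 - h') (B j')) _ _ (Ylinl e z)).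
Qed.

End Theta.

(** * Consequences of the Jacobi identity *)

Section ResidueKernels.
Variable K : numFieldType.
Implicit Types (x : K) (i l a : int).

Definition gbinomz x i : K := if i is Posz n then gbinom x n else 0.

Lemma gbinomz_neg x i : i < 0 -> gbinomz x i = 0.
Proof. by case: i. Qed.

Lemma gbinomzD1 x i : gbinomz (x + 1) i = gbinomz x i + gbinomz x (i - 1).
Proof.
case: i => [[|i]|i].
- by rewrite /= !gbinom0 addr0.
- have -> : Posz i.+1 - 1 = Posz i by lia.
  exact: gbinomD1.
by rewrite gbinomz_neg ?gbinomz_neg ?addr0 //; lia.
Qed.

Lemma signzD1 a : (-1) ^ (a + 1) = - (-1) ^ a :> K.
Proof. by rewrite expfzDr ?oppr_eq0 ?oner_eq0 // expr1z mulrN1. Qed.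

(* The coefficients of x1^(-a-1) x2^(a+1+l) in (x1 - x2)^l and (-x2 + x1)^l. *)
Definition ker1 l a : K := (-1) ^ (a + 1 + l) * gbinomz l%:~R (a + 1 + l).
Definition ker2 l a : K := (-1) ^ (a + 1 + l) * gbinomz l%:~R (- 1 - a).

Lemma ker1_step l a : ker1 (l + 1) a = ker1 l (a + 1) - ker1 l a.
Proof.
rewrite /ker1 intrD gbinomzD1.
have -> : a + 1 + (l + 1) - 1 = a + 1 + l by lia.
have -> : a + 1 + 1 + l = a + 1 + (l + 1) by lia.
rewrite addrA signzD1; ring.
Qed.

Lemma ker2_step l a : ker2 (l + 1) a = ker2 l (a + 1) - ker2 l a.
Proof.
rewrite /ker2 intrD gbinomzD1.
have -> : - 1 - a - 1 = - 1 - (a + 1) by lia.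
have -> : a + 1 + 1 + l = a + 1 + (l + 1) by lia.
rewrite addrA signzD1; ring.
Qed.

Lemma ker1_low l a : a < - 1 - l -> ker1 l a = 0.
Proof. by move=> al; rewrite /ker1 gbinomz_neg ?mulr0 //; lia. Qed.

Lemma ker2_high l a : - 1 < a -> ker2 l a = 0.
Proof. by move=> al; rewrite /ker2 gbinomz_neg ?mulr0 //; lia. Qed.

(* The expansions of (x1 - x2)^(-1-i) differ by the i-th derivative of the
   formal delta function. *)
Lemma ker_diff i a : ker1 (- 1 - i) a - ker2 (- 1 - i) a = gbinomz a%:~R i.
Proof.
(* For i < 0 the two expansions are the same polynomial. For i >= 0 the recurrence fixes the
   differences of f i in a, and the value at 0 does the rest. *)
pose f i a := ker1 (- 1 - i) a - ker2 (- 1 - i) a.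
have step j b : f (j - 1) b = f j (b + 1) - f j b.
  rewrite /f (_ : - 1 - (j - 1) = - 1 - j + 1); last by lia.
  by rewrite ker1_step ker2_step !opprD !opprK addrACA.
have neg n b : f (- 1 - n%:Z) b = 0.
  elim: n b => [|n IH] b; last first.
    by rewrite (_ : - 1 - n.+1%:Z = - 1 - n%:Z - 1) ?step ?IH ?subrr //; lia.
  rewrite /f /ker1 /ker2 -mulrBr (_ : - 1 - (- 1 - 0%N%:Z) = 0); last by lia.
  have g0 (j : int) : gbinomz (0 : K) j = (j == 0)%:R.
    case: j => [[|j]|j] //=; first by rewrite gbinom0.
    by rewrite /gbinom big_ord_recl subrr !mul0r.
  rewrite g0 g0 (_ : (b + 1 + 0 == 0) = (- 1 - b == 0)) ?subrr ?mulr0 //; lia.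
have pos n b : f n%:Z b = gbinomz b%:~R n.
  elim: n b => [|n IH] b.
    have rec c : f 0 (c + 1) = f 0 c.
      by apply/eqP; rewrite -subr_eq0 -step -[0 - 1]/(- 1 - 0%N%:Z) neg.
    have f00 : f 0 0 = 1.
      rewrite /f /ker1 /ker2 (_ : 0 + 1 + (- 1 - 0) = 0) //.
      by rewrite (@gbinomz_neg _ (- 1 - 0)) // mulr0 subr0 expr0z mul1r /= gbinom0.
    suff -> : f 0 b = 1 by rewrite /= gbinom0.
    elim: b => [|b IHb|b IHb] //; first by rewrite -addn1 PoszD rec.
    by rewrite -IHb -[in RHS](subrK 1 (- b%:Z)) rec; congr f; lia.
  have rec c : f n.+1%:Z (c + 1) = f n.+1%:Z c + gbinomz c%:~R n.
    have E : f n%:Z c = f n.+1%:Z (c + 1) - f n.+1%:Z c.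
      by rewrite -step; congr f; lia.
    by rewrite -IH E subrKC.
  have recb c : gbinomz (c + 1)%:~R n.+1 = gbinomz (c%:~R : K) n.+1 + gbinomz c%:~R n.
    by rewrite intrD gbinomzD1; congr (_ + gbinomz _ _); lia.
  elim: b => [|b IHb|b IHb].
  - rewrite /f /ker1 /ker2 (@gbinomz_neg _ (_ + (- 1 - _))); last by lia.
    rewrite (@gbinomz_neg _ (- 1 - 0)) // !mulr0 subr0.
    by rewrite /= /gbinom big_ord_recl subrr !mul0r.
  - have -> : b.+1%:Z = b%:Z + 1 by lia.
    by rewrite rec recb IHb.
  have E : - b%:Z = - b.+1%:Z + 1 by lia.
  by apply: (addIr (gbinomz (- b.+1%:Z)%:~R n)); rewrite -rec -recb -E.
case: i => [i|i]; first exact: pos.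
by have := neg i a; rewrite /f (_ : - 1 - i%:Z = Negz i) //; lia.
Qed.

End ResidueKernels.

Section Residues.
Variables (K : numFieldType) (W : lmodType K).
Implicit Types (F G : int -> int -> W) (l c a b i : int).

(* Res_x1 ((x1 - x2)^l F - (-x2 + x1)^l G), at x2^c. *)
Definition residue l F G c : W :=
  tsum (fun a => ker1 K l a *: F a (c - 1 - l - a)) -
  tsum (fun a => ker2 K l a *: G a (c - 1 - l - a)).

Definition low1 F := exists N : int, forall a b, a < N -> F a b = 0.
Definition low2 F := exists N : int, forall a b, b < N -> F a b = 0.

Lemma tsum_ker_dif (ker ker' : int -> K) F (d : int) :
  (forall a, ker' a = ker (a + 1) - ker a) ->
  fsupp (fun a => ker (a + 1) *: F a (d - a)) ->
  fsupp (fun a => ker a *: F a (d - a)) ->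
  tsum (fun a => ker a *: dif 1 F a (d + 1 - a)) =
  tsum (fun a => ker' a *: F a (d - a)).
Proof.
move=> kerE f1 f2.
have f1' : fsupp (fun a => ker a *: F (a - 1) (d + 1 - a)).
  apply: (fsupp_sub (fsupp_shift (- 1) f1)) => a <-; rewrite subrK.
  by congr (_ *: F _ _); lia.
have f2' : fsupp (fun a => - (ker a *: F a (d - a))).
  by apply: (fsupp_sub f2) => a ->; rewrite oppr0.
transitivity (tsum (fun a => ker a *: F (a - 1) (d + 1 - a)) +
              tsum (fun a => - (ker a *: F a (d - a)))).
  rewrite -tsumD //; apply: eq_tsum => a; rewrite difE scalerBr.
  by congr (_ - _ *: F _ _); lia.
rewrite -(tsum_shift _ 1) -tsumD //; last first.
  by apply: (fsupp_sub f1) => a <-; congr (_ *: F _ _); lia.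
apply: eq_tsum => a; rewrite kerE scalerBl.
by congr (_ *: F _ _ - _); lia.
Qed.

Lemma fsupp_ker1 F l c d : low2 F ->
  fsupp (fun a => ker1 K l (a + d) *: F a (c - a)).
Proof.
move=> [N FN]; apply: (@fsupp_bounded _ _ _ (- 1 - l - d) (c - N)) => a al.
  by rewrite ker1_low ?scale0r //; lia.
by rewrite FN ?scaler0 //; lia.
Qed.

Lemma fsupp_ker2 F l c d : low1 F ->
  fsupp (fun a => ker2 K l (a + d) *: F a (c - a)).
Proof.
move=> [N FN]; apply: (@fsupp_bounded _ _ _ N (- 1 - d)) => a al.
  by rewrite FN ?scaler0.
by rewrite ker2_high ?scale0r //; lia.
Qed.

(** The bounds are asymmetric because (x1 - x2)^l has no negative powers of x2 and (-x2 + x1)^l none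
    of x1; each kernel pairs finitely with a series bounded in the variable concerned. *)
Lemma residue_dif l F G c : low2 F -> low1 G ->
  residue l (dif 1 F) (dif 1 G) c = residue (l + 1) F G c.
Proof.
move=> F2 G1; rewrite /residue.
have E : c - 1 - l = c - 1 - (l + 1) + 1 by lia.
have H1 := fsupp_ker1 l (c - 1 - (l + 1)) 0 F2.
have H2 := fsupp_ker2 l (c - 1 - (l + 1)) 0 G1.
rewrite E (tsum_ker_dif (ker1_step K l)); first last.
- by apply: (fsupp_sub H1) => a; rewrite addr0.
- exact: fsupp_ker1.
rewrite (tsum_ker_dif (ker2_step K l)) //; first exact: fsupp_ker2.
by apply: (fsupp_sub H2) => a; rewrite addr0.
Qed.

Lemma low1_iter_dif k F : low1 F -> low1 (iter k (dif 1) F).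
Proof. by move=> [N FN]; exists N; apply: iter_dif_low1. Qed.

Lemma low2_iter_dif k F : low2 F -> low2 (iter k (dif 1) F).
Proof. by move=> [N FN]; exists N; apply: iter_dif_low2. Qed.

Lemma residue_iter_dif k l F G c : low2 F -> low1 G ->
  residue l (iter k (dif 1) F) (iter k (dif 1) G) c = residue (l + k%:Z) F G c.
Proof.
move=> F2 G1; elim: k l => [|k IH] l; first by rewrite addr0.
rewrite /= residue_dif; [|exact: low2_iter_dif|exact: low1_iter_dif].
by rewrite IH; congr residue; lia.
Qed.

(** For equal series the kernels combine into a derivative of the delta function, whose residue is a
    Taylor coefficient of F(x2 + x0, x2). *)
Lemma residue_limit s i F c : low1 F -> low2 F ->
  residue (- 1 - i) F F c = limit_coef 1 (1 : K) s F i c.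
Proof.
move=> F1 F2; rewrite /residue -scaleN1r -tsumZ -tsumD.
- transitivity (tsum (fun a => gbinomz (a%:~R : K) i *: F a (c + i - a))).
    apply: eq_tsum => a; rewrite -ker_diff scaleN1r scalerBl.
    by congr (_ *: F _ _ - _ *: F _ _); lia.
  case: i => [i|i]; last by apply: tsum0 => a; rewrite scale0r.
  apply: eq_tsum => a; rewrite /limit_term exp1rz mul1r divr1.
  by congr (_ *: F _ _); lia.
- have H := fsupp_ker1 (- 1 - i) (c - 1 - (- 1 - i)) 0 F2.
  by apply: (fsupp_sub H) => a; rewrite addr0.
have H := fsupp_ker2 (- 1 - i) (c - 1 - (- 1 - i)) 0 F1.
by apply: (fsupp_sub H) => a; rewrite addr0 => ->; rewrite scaler0.
Qed.

End Residues.

Section VertexAlgebra.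
Variables (K : numFieldType) (V : lmodType K) (X : voa V).
Local Notation Y := (fcoef 1 (vmode X)).
Local Notation ser := (ser2 1 (vmode X)).
Local Notation wcV := (weak_commutativity 1 (vmode X)).
Implicit Types (u v w x : V).

Definition op_ser u v x (a b : int) : V := Y v b (Y u a x).

Lemma fcoefE v e x : Y v e x = vmode X v (- e - 1) x.
Proof. by []. Qed.

Lemma mode_linearr v n : linear (vmode X v n).
Proof. exact: vmode_linearr. Qed.

Lemma mode_linearl n x : linear (fun v => vmode X v n x).
Proof. exact: vmode_linearl. Qed.

Lemma mode0 n x : vmode X 0 n x = 0.
Proof. exact: (lin0 (mode_linearl n x)). Qed.

Lemma mode_low v x : exists N : int, forall e, e < N -> Y v e x = 0.
Proof. exact: (fcoef_low 1 (vmode_trunc X)). Qed.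

Lemma ser_low2 u v x : low2 (ser u v x).
Proof.
have [N HN] := mode_low v x; exists N => a b bN.
by rewrite /ser2 HN //; apply: (lin0 (mode_linearr _ _)).
Qed.

Lemma op_ser_low1 u v x : low1 (op_ser u v x).
Proof.
have [N HN] := mode_low u x; exists N => a b bN.
by rewrite /op_ser HN //; apply: (lin0 (mode_linearr _ _)).
Qed.

(** The Jacobi identity at m = 0, where binom(0, i) leaves a single term on the right. Its sum of
    differences may be split because each half is finite by truncation. *)
Lemma mode_residue u v x l c :
  residue l (ser u v x) (op_ser u v x) c = Y (vmode X u l v) c x.
Proof.
have := jacobi X u v x l 0 (- c - 1).
have g0 i : (i != 0)%N -> gbinom (0 : K) i = 0.
  by case: i => // i _; rewrite /gbinom big_ord_recl subrr !mul0r.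
rewrite -[X in _ = X -> _]/(tsum _) (@tsum1 _ _ _ _ 0%N); last first.
  by move=> i i0; rewrite g0 // scale0r.
rewrite gbinom0 scale1r [X in _ = X -> _](_ : _ = Y (vmode X u l v) c x); last first.
  by rewrite fcoefE; congr (vmode X (vmode X _ _ _) _ _); lia.
move=> <-.
pose f1 (i : nat) : V := ((-1) ^+ i * gbinom (l%:~R : K) i) *:
  vmode X u (0 + l - i%:Z) (vmode X v (- c - 1 + i%:Z) x).
pose f2 (i : nat) : V := ((-1) ^+ i * gbinom (l%:~R : K) i * (-1) ^ l) *:
  vmode X v (- c - 1 + l - i%:Z) (vmode X u (0 + i%:Z) x).
have E1 : forall i, ker1 K l (- 1 - l + i%:Z) *:
    ser u v x (- 1 - l + i%:Z) (c - 1 - l - (- 1 - l + i%:Z)) = f1 i.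
  move=> i; rewrite /ker1 /ser2 !fcoefE /f1.
  rewrite (_ : - 1 - l + i%:Z + 1 + l = i%:Z); last by lia.
  by congr (_ *: vmode X _ _ (vmode X _ _ _)); lia.
have E2 : forall i : nat, ker2 K l (- 1 - (0 + i%:Z)) *:
    op_ser u v x (- 1 - (0 + i%:Z)) (c - 1 - l - (- 1 - (0 + i%:Z))) = f2 i.
  move=> i; rewrite /ker2 /op_ser !fcoefE /f2.
  rewrite (_ : - 1 - (- 1 - (0 + i%:Z)) = i%:Z); last by lia.
  rewrite (_ : - 1 - (0 + i%:Z) + 1 + l = l - i%:Z); last by lia.
  rewrite expfzDr ?oppr_eq0 ?oner_eq0 // -exprz_inv invrN1.
  congr (_ *: vmode X _ _ (vmode X _ _ _)); [|lia|lia].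
  by rewrite /gbinomz -exprnP; ring.
have F1 := fsupp_ker1 l (c - 1 - l) 0 (ser_low2 u v x).
have F2 := fsupp_ker2 l (c - 1 - l) 0 (op_ser_low1 u v x).
have S1 : fsupp f1.
  have F1' : fsupp (fun a => ker1 K l a *: ser u v x a (c - 1 - l - a)).
    by apply: (fsupp_sub F1) => a; rewrite addr0.
  have inj : cancel (fun i : nat => - 1 - l + i%:Z) (fun a => absz (a + 1 + l)%R).
    by move=> i; lia.
  by apply: (fsupp_sub (fsupp_reindex inj F1')) => i; rewrite E1.
have S2 : fsupp f2.
  have F2' : fsupp (fun a => ker2 K l a *: op_ser u v x a (c - 1 - l - a)).
    by apply: (fsupp_sub F2) => a; rewrite addr0.
  have inj : cancel (fun i : nat => - 1 - (0 + i%:Z)) (fun a => absz (- 1 - a)%R).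
    by move=> i; lia.
  by apply: (fsupp_sub (fsupp_reindex inj F2')) => i; rewrite E2.
rewrite -[RHS]/(tsum _).
transitivity (tsum f1 + tsum (fun i => -1 *: f2 i)).
  rewrite tsumZ scaleN1r; congr (_ - _).
    rewrite (@tsum_nat _ _ _ (- 1 - l)) => [|a al].
      by apply: eq_tsum => i; rewrite E1.
    by rewrite ker1_low ?scale0r.
  have invol : involutive (fun a : int => - 1 - a) by move=> a; lia.
  rewrite -(tsum_reindex _ invol invol) (@tsum_nat _ _ _ 0) => [|a al].
    by apply: eq_tsum => i; rewrite E2.
  by rewrite ker2_high ?scale0r //; lia.
rewrite -tsumD //; last by apply: (fsupp_sub S2) => i ->; rewrite scaler0.
by apply: eq_tsum => i; rewrite scaleN1r scalerBr scalerA.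
Qed.

Definition voa_id : voa_aut X.
Proof.
by apply: (@VoaAut _ _ X (fun v => v) (fun v => v)).
Defined.

Lemma aut_pow_id s v : aut_pow voa_id s v = v.
Proof.
have E f n : f =1 id -> iter n f v = v by move=> fE; elim: n => //= n ->; apply: fE.
by case: s => n; [exact: (E _ n)|exact: (E _ n.+1)].
Qed.

Lemma iter_dif_op_ser u v k x : wcV u v k ->
  iter k (dif 1) (ser u v x) = iter k (dif 1) (op_ser u v x).
Proof.
move=> /weak_commutativityP H; apply/funext => a; apply/funext => b.
by apply/eqP; rewrite -subr_eq0 -iter_difB; apply/eqP/H.
Qed.

(** After multiplication by (x1 - x2)^k both orders are one series, so its Taylor coefficient is a
    residue with l = -1 - i; absorbing the factor into l yields the mode k - 1 - i of [u]. *)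
Lemma voa_assoc u v k s : wcV u v k -> assoc_at 1 (1 : K) voa_id (vmode X) s u v k.
Proof.
move=> uv x; split=> [|i c].
  exact: (ser2_dif_fin (vmode_trunc X) mode_linearr x uv).
have E := iter_dif_op_ser x uv.
have G1 := low1_iter_dif k (op_ser_low1 u v x); rewrite -E in G1.
have G2 := low2_iter_dif k (ser_low2 u v x).
rewrite aut_pow_id -residue_limit // {2}E.
rewrite residue_iter_dif; [|exact: ser_low2|exact: op_ser_low1].
by rewrite mode_residue; congr (Y (vmode X u _ v) c x); lia.
Qed.

Lemma jacobi_comm u v x k (m n : int) :
  iter k (dif 1) (comm_ser 1 (vmode X) u v x) (- m - 1) (- n - 1) =
  tsum (fun i : nat => gbinom (m%:~R : K) i *:
    vmode X (vmode X u (k%:Z + i%:Z) v) (m + n - i%:Z) x).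
Proof.
rewrite -[RHS](jacobi X) -binom_mulE.
rewrite -[RHS]/(tsum _) (tsum_seq (r := iota 0 k.+1)) ?iota_uniq //; last first.
  move=> i; rewrite mem_iota add0n; apply: contraNT; rewrite -leqNgt => ki.
  by rewrite -pmulrn gbinom_nat bin_small // mulr0 scale0r.
rewrite -[iota _ _]/(index_iota 0 k.+1) big_mkord.
pose A (i : nat) := vmode X u (m + k%:Z - i%:Z) (vmode X v (n + i%:Z) x).
pose B (i : nat) := vmode X v (n + k%:Z - i%:Z) (vmode X u (m + i%:Z) x).
pose c (i : nat) : K := (-1) ^+ i * 'C(k, i)%:R.
transitivity (\sum_(i < k.+1) c i *: A i - \sum_(i < k.+1) c i *: B (k - i)%N).
  rewrite -sumrB; apply: eq_bigr => i _; rewrite -scalerBr; congr (_ *: _).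
  have ik : (i <= k)%N by rewrite -ltnS.
  rewrite /comm_ser /ser2 !fcoefE /A /B.
  by congr (vmode X _ _ (vmode X _ _ _) - vmode X _ _ (vmode X _ _ _)); lia.
rewrite [X in _ - X](reindex_inj rev_ord_inj) -sumrB; apply: eq_bigr => i _ /=.
have ik : (i <= k)%N by rewrite -ltnS.
rewrite subSS subKn // -pmulrn gbinom_nat scalerBr scalerA -exprnP.
congr (_ - _ *: _); rewrite /c bin_sub //.
have -> : (-1) ^+ k = (-1) ^+ (k - i) * (-1) ^+ i :> K by rewrite -exprD subnK.
rewrite [RHS](_ : _ = ((-1) ^+ i) ^+ 2 * ((-1) ^+ (k - i) * 'C(k, i)%:R)).
  by rewrite sqrr_sign mul1r.
by ring.
Qed.

Lemma weak_commutativity_voa u v k :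
  (forall n : int, k%:Z <= n -> vmode X u n v = 0) -> wcV u v k.
Proof.
move=> uv; apply/weak_commutativityP => x a b.
rewrite [a](_ : _ = - (- a - 1) - 1); last by lia.
rewrite [b](_ : _ = - (- b - 1) - 1); last by lia.
rewrite jacobi_comm; apply: tsum0 => i.
by rewrite uv ?mode0 ?scaler0 //; lia.
Qed.

(** Converse of [weak_commutativity_voa]: on the vacuum, [jacobi_comm] reduces to (u_n v)_(-1) vac =
    u_n v, the exponent having been raised to n. In V an exponent is thus a bound on a pole
    order. *)
Lemma weak_commutativity_voa_mode u v k (n : int) :
  wcV u v k -> k%:Z <= n -> vmode X u n v = 0.
Proof.
move=> uv kn; have {}uv : wcV u v `|n|%N by apply: (weak_commutativity_up _ uv); lia.
have -> : n = `|n|%N by lia.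
move: {kn}`|n|%N uv => {n k} k /weak_commutativityP uv.
have := uv (vac X) (- 0 - 1) (- (- 1) - 1); rewrite jacobi_comm.
rewrite (@tsum1 _ _ _ _ 0%N); last first.
  case=> // i _; rewrite /gbinom big_ord_recl subrr !mul0r scale0r //.
rewrite gbinom0 scale1r addr0 add0r subr0.
by have [-> _] := creation X (vmode X u k v).
Qed.

Lemma weak_commutativity_voa_exists u v : exists k, wcV u v k.
Proof.
have [N HN] := vmode_trunc X u v; exists `|N|%N.
by apply: weak_commutativity_voa => n Nn; apply: HN; lia.
Qed.

(** Division by x1 - x2 from the lowest power of x2 upwards: F (a - 1) b is [dif 1 F a b] plus F a
    (b - 1), so each factor removed and each step above [b0] costs one in the bound on a. *)
Lemma dif_low_corner (F : int -> int -> V) k (a0 b0 : int) :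
  (forall a b, b < b0 -> F a b = 0) ->
  (forall a b, a < a0 -> iter k (dif 1) F a b = 0) ->
  forall (m : nat) a, a < a0 - k%:Z - m%:Z -> F a (b0 + m%:Z) = 0.
Proof.
elim: k F => [|k IH] F Fb Fa; first by move=> m a am; apply: Fa; lia.
have {}IH := IH (dif 1 F) _ _.
have Db a b : b < b0 -> dif 1 F a b = 0.
  by move=> bb; rewrite difE !Fb ?subrr //; lia.
have {}IH := IH Db; rewrite iterSr in Fa; have {}IH := IH Fa.
elim=> [|m IHm] a am.
  have := IH 0%N (a + 1); rewrite difE (Fb (a + 1)); last by lia.
  by rewrite !subr0 addrK; apply; lia.
have := IH m.+1 (a + 1); rewrite difE addrK.
have -> : b0 + m.+1%:Z - 1%N%:Z = b0 + m%:Z by lia.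
by rewrite (IHm (a + 1)) ?subr0; [apply|]; lia.
Qed.

(** By the pole order criterion it suffices to locate the lowest powers of x1 in Y(w, x1) Y(u, x2)
    v; after (x1 - x2)^k1 they are those of Y(w, x1) v, bounded by k2. *)
Lemma weak_commutativity_voa_comp u v w k1 k2 (n0 : int) m :
  (forall n, n0 < n -> vmode X u n v = 0) -> wcV w u k1 -> wcV w v k2 ->
  wcV w (vmode X u (n0 - m%:Z) v) (k1 + k2 + m).
Proof.
move=> n0P wu wv; apply: weak_commutativity_voa => n nk.
have low2 a b : b < - n0 - 1 -> ser w u v a b = 0.
  move=> bn; rewrite /ser2 !fcoefE n0P; last by lia.
  exact: (lin0 (mode_linearr _ _)).
have low1 a b : a < - k2%:Z -> iter k1 (dif 1) (ser w u v) a b = 0.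
  rewrite (iter_dif_op_ser v wu); move: a b; apply: iter_dif_low1 => a b ak.
  rewrite /op_ser !fcoefE (weak_commutativity_voa_mode wv); last by lia.
  exact: (lin0 (mode_linearr _ _)).
have := dif_low_corner low2 low1 (m := m) (a := - n - 1).
rewrite /ser2 !fcoefE.
have -> : - (- n - 1) - 1 = n by lia.
have -> : - (- n0 - 1 + m%:Z) - 1 = n0 - m%:Z by lia.
by apply; lia.
Qed.

End VertexAlgebra.

(** * Extension from a generating subset *)

Section Generation.
Variables (K : numFieldType) (V : lmodType K) (X : voa V) (U : set V).

Inductive mode_span : V -> Prop :=
| MSpanGen u : U u -> mode_span u
| MSpanMode u n v : U u -> mode_span v -> mode_span (vmode X u n v)
| MSpan0 : mode_span 0
| MSpanLin c x y : mode_span x -> mode_span y -> mode_span (c *: x + y).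

Lemma mode_span_sum (I : Type) (r : seq I) (F : I -> V) :
  (forall i, mode_span (F i)) -> mode_span (\sum_(i <- r) F i).
Proof.
move=> HF; elim: r => [|i r IH]; first by rewrite big_nil; apply: MSpan0.
by rewrite big_cons -[F i]scale1r; apply: MSpanLin.
Qed.

Lemma mode_spanZ c x : mode_span x -> mode_span (c *: x).
Proof. by move=> Sx; rewrite -[_ *: _]addr0; apply: MSpanLin => //; apply: MSpan0. Qed.

Lemma mode_spanB x y : mode_span x -> mode_span y -> mode_span (x - y).
Proof. by move=> Sx Sy; rewrite addrC -scaleN1r; apply: MSpanLin. Qed.

(** The Jacobi identity at m = 0 writes the modes of u_l v through those of [u] and [v], so
    stability passes from letters to words. *)
Lemma mode_span_iterate u l v : U u ->
  (forall n x, mode_span x -> mode_span (vmode X v n x)) ->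
  forall n x, mode_span x -> mode_span (vmode X (vmode X u l v) n x).
Proof.
move=> Uu Sv n x Sx.
have := jacobi X u v x l 0 n; rewrite [RHS](_ : _ = vmode X (vmode X u l v) n x).
  move=> <-; apply: mode_span_sum => i; apply: mode_spanZ; apply: mode_spanB.
    by apply: MSpanMode => //; apply: Sv.
  by apply: mode_spanZ; apply: Sv; apply: MSpanMode.
rewrite -[LHS]/(tsum _) (@tsum1 _ _ _ _ 0%N) => [|[|i] // _]; last first.
  by rewrite /gbinom big_ord_recl subrr !mul0r scale0r.
by rewrite gbinom0 scale1r; congr (vmode X (vmode X _ _ _) _ _); lia.
Qed.

Lemma mode_span_word v : mode_word X U v ->
  forall n x, mode_span x -> mode_span (vmode X v n x).
Proof.
elim=> {v} [u l Uu|u l v Uu _ IH]; apply: mode_span_iterate => // n x Sx.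
by rewrite vac_identity; case: ifP => // _; apply: MSpan0.
Qed.

Hypothesis U_gen : generating X U.

Lemma mode_span_ideal v n x : mode_span x -> mode_span (vmode X v n x).
Proof.
move=> Sx; have [d [c [f [fw ->]]]] := U_gen v.
rewrite (lin_sum _ _ _ (mode_linearl X n x)); apply: mode_span_sum => i.
rewrite (linZ _ _ (mode_linearl X n x)); apply: mode_spanZ.
exact: mode_span_word.
Qed.

(* The span is stable under all modes, hence under L(-1) = omega_0, hence it is
   a two-sided ideal; it contains U, so it contains the words ending in
   u_n vac. *)
Lemma mode_span_creation x j : mode_span x ->
  mode_span (vmode X x (- 1 - j%:Z) (vac X)).
Proof.
elim: j x => [|j IH] x Sx.
  by rewrite subr0; have [-> _] := creation X x.
have := IH _ (mode_span_ideal (conformal X) 0 Sx).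
rewrite L_1_derivative (_ : - 1 - j%:Z - 1 = - 1 - j.+1%:Z); last by lia.
move=> /(mode_spanZ (j.+1%:R)^-1); rewrite scalerA.
have -> : (j.+1%:R)^-1 * - (- 1 - j%:Z)%:~R = 1 :> K.
  rewrite (_ : - 1 - j%:Z = - (j.+1%:Z)); last by lia.
  by rewrite intrN opprK -pmulrn mulVf // pnatr_eq0.
by rewrite scale1r.
Qed.

Lemma mode_span_full v : mode_span v.
Proof.
have [d [c [f [fw ->]]]] := U_gen v; apply: mode_span_sum => i; apply: mode_spanZ.
elim: (fw i) => [u n Uu|u n y Uu _ Sy]; last exact: MSpanMode.
have [n0|n0] := ltP n 0.
  have -> : n = - 1 - (absz (- 1 - n)%R)%:Z by lia.
  by apply: mode_span_creation; apply: MSpanGen.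
by have [_ ->] := creation X u; [apply: MSpan0|].
Qed.

End Generation.

Section Automorphisms.
Variables (K : numFieldType) (V : lmodType K) (X : voa V) (nu : voa_aut X).

Lemma aut_inv_linear : linear (aut_inv nu).
Proof.
by move=> c x y; rewrite -{1}(aut_invK nu x) -{1}(aut_invK nu y) -aut_linear autK.
Qed.

Lemma aut_pow_linear s : linear (aut_pow nu s).
Proof.
have E f n : linear f -> linear (iter n f : V -> V).
  by move=> lf; elim: n => //= n IH c x y; rewrite !iterS IH lf.
by case: s => n; apply: E; [exact: aut_linear|exact: aut_inv_linear].
Qed.

Lemma aut_pow_mode s u n v :
  aut_pow nu s (vmode X u n v) = vmode X (aut_pow nu s u) n (aut_pow nu s v).
Proof.
have E x m y : aut nu (vmode X x m y) = vmode X (aut nu x) m (aut nu y).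
  by rewrite -{1}(autK nu y) aut_vmode.
have E' x m y : aut_inv nu (vmode X x m y) = vmode X (aut_inv nu x) m (aut_inv nu y).
  by rewrite -{1}(aut_invK nu x) -{1}(aut_invK nu y) -E autK.
have I f k : (forall x m y, f (vmode X x m y) = vmode X (f x) m (f y)) ->
    iter k f (vmode X u n v) = vmode X (iter k f u) n (iter k f v).
  by move=> fE; elim: k => //= k ->.
by case: s => k; apply: I.
Qed.

End Automorphisms.

(** Applied to the vectors u_(g-1-j) v, which vanish for small j by truncation, so that only
    finitely many exponents have to be added up. *)
Lemma uniform_bound (P : int -> nat -> Prop) (N J : int) :
  (forall j t t', (t <= t')%N -> P j t -> P j t') ->
  (forall j, j < N -> P j 0%N) -> (forall j, exists t, P j t) ->
  exists t, forall j, j <= J -> P j t.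
Proof.
move=> Pup PN Pex.
suff H n : exists t, forall j, j < N + n%:Z -> P j t.
  by have [t Ht] := H `|J - N|%N.+1; exists t => j jJ; apply: Ht; lia.
elim: n => [|n [t Ht]]; first by exists 0%N => j; rewrite addr0; apply: PN.
have [t' Ht'] := Pex (N + n%:Z); exists (t + t')%N => j jn.
have [E|E] := eqVneq j (N + n%:Z).
  by rewrite E; apply: Pup Ht'; apply: leq_addl.
by apply: (Pup _ t); [apply: leq_addr | apply: Ht; lia].
Qed.

Section Closure.
Variables (K : numFieldType) (V : lmodType K) (X : voa V).
Variables (M : lmodType K) (p : nat) (omega : K) (nu : voa_aut X).
Variable YM : V -> int -> M -> M.
Hypotheses (p_gt0 : (0 < p)%N) (omega_p : omega ^+ p = 1).
Hypothesis YM_linearl : forall j w, linear (fun v => YM v j w).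
Hypothesis YM_linearr : forall v j, linear (YM v j).
Hypothesis YM_trunc :
  forall v w, exists N : int, forall j, N <= j -> YM v j w = 0.

Local Notation Y := (fcoef p YM).
Local Notation wc := (weak_commutativity p YM).
Local Notation assoc := (assoc_at p omega nu YM).

Lemma assoc_at_lin s c u u' v k : assoc s u v k -> assoc s u' v k ->
  assoc s (c *: u + u') v k.
Proof.
move=> H H' w; have [f e] := H w; have [f' e'] := H' w.
have E : iter k (dif p) (ser2 p YM (c *: u + u') v w) =
   fun a b => c *: iter k (dif p) (ser2 p YM u v w) a b +
              iter k (dif p) (ser2 p YM u' v w) a b.
  have -> : ser2 p YM (c *: u + u') v w =
      fun a b => c *: ser2 p YM u v w a b + ser2 p YM u' v w a b.
    by do 2 apply/funext => ?; rewrite /ser2 /fcoef YM_linearl.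
  apply/funext => a; apply/funext => b; rewrite iter_difD; congr (_ + _).
  apply: (iter_dif_lin p k (ser2 p YM u v w) (h := fun x => c *: x)).
  by move=> k' x y; rewrite scalerDr !scalerA mulrC.
rewrite E; split=> [|i b]; first exact/fin_diagD/f'/fin_diagZ.
rewrite limitD //; last exact: fin_diagZ.
rewrite limitZ e e' aut_pow_linear.
by rewrite (vmode_linearl X) /fcoef YM_linearl.
Qed.

Lemma assoc_at_zero s u v k : (u = 0) \/ (v = 0) -> assoc s u v k.
Proof.
have Y0 e x : Y 0 e x = 0 by exact: (lin0 (YM_linearl _ _)).
move=> uv w; have F0 a b : iter k (dif p) (ser2 p YM u v w) a b = 0.
  apply: iter_dif0 => {}a {}b; rewrite /ser2; case: uv => ->; rewrite Y0 //.
  exact: (lin0 (YM_linearr _ _)).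
split=> [c|i c]; first by exists [::] => a; rewrite F0 eqxx.
transitivity (limit_coef p omega s (fun _ _ => 0 : M) i c); first exact: eq_limit.
rewrite limit0; case: uv => ->.
  by rewrite (lin0 (aut_pow_linear nu _)) mode0 Y0.
by rewrite (lin0 (mode_linearr X _ _)) Y0.
Qed.

Lemma assoc_uniform s w u v (g J : int) : (forall x, exists t, assoc s w x t) ->
  exists t, forall j' : int, j' <= J -> assoc s w (vmode X u (g - 1 - j') v) t.
Proof.
move=> H; have [N HN] := vmode_trunc X u v.
apply: (uniform_bound (P := fun j t => assoc s w (vmode X u (g - 1 - j) v) t)
         (N := g - N)) => [j t t' tt'|j jN|j]; last exact: H.
  exact: assoc_at_up.
by apply: assoc_at_zero; right; apply: HN; lia.
Qed.

Lemma weak_commutativity_uniform w u v (g J : int) :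
  (forall x y, exists k, wc x y k) ->
  exists t, forall j' : int, j' <= J -> wc (vmode X w (g - 1 - j') u) v t.
Proof.
move=> H; have [N HN] := vmode_trunc X w u.
apply: (uniform_bound (P := fun j t => wc (vmode X w (g - 1 - j) u) v t)
         (N := g - N)) => [j t t' tt'|j jN|j]; last exact: H.
  exact: weak_commutativity_up.
apply: weak_commutativity_sym; rewrite HN; last by lia.
exact: weak_commutativity0.
Qed.

Lemma weak_commutativity_span (U : set V) x :
  (forall u v, U u -> exists k, assoc 0 u v k) ->
  (forall u, U u -> exists k, wc x u k) ->
  forall v, mode_span X U v -> exists k, wc x v k.
Proof.
move=> Uas Ux v; elim=> {v} [u /Ux //|u n v Uu _ [k2 xv]||c y y' _ [k xy] _ [k' xy']].
- have [k1 xu] := Ux u Uu; have [k' uv] := Uas u v Uu.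
  have [N HN] := vmode_trunc X u v.
  (* Any bound above both N and n serves, as only the existence of an exponent is wanted. *)
  pose n0 : int := `|N| + `|n|; pose m := `|n0 - n|%N.
  have -> : n = n0 - m%:Z by rewrite /m /n0; lia.
  exists (k1 + k2 + m)%N.
  apply: (weak_commutativity_mode _ _ _ _ _ uv) => // n' nn'.
  by apply: HN; rewrite /n0 in nn'; lia.
- by exists 0%N; apply: weak_commutativity0.
exists (k + k')%N; apply: weak_commutativity_lin => //.
  exact: weak_commutativity_up (leq_addr _ _) xy.
exact: weak_commutativity_up (leq_addl _ _) xy'.
Qed.

End Closure.

(** * Modified weak associativity for w_n u *)

Lemma iter_opF_low (K : numFieldType) (W : lmodType K) k eps
    (R : int -> int -> W) (I : int) :
  (forall i j, i <= I -> j < 0 -> R i j = 0) ->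
  forall i j, i <= I -> j < 0 -> iter k (opF eps) R i j = 0.
Proof.
move=> R0; elim: k => //= k IH i j iI j0.
by rewrite opFE !IH ?scaler0 ?addr0 //; lia.
Qed.

Section AssociativityOfModes.
Variables (K : numFieldType) (V : lmodType K) (X : voa V).
Variables (M : lmodType K) (p : nat) (omega : K) (nu : voa_aut X).
Variable YM : V -> int -> M -> M.
Hypotheses (p_gt0 : (0 < p)%N) (omega_p : omega ^+ p = 1).
Hypothesis YM_linearl : forall j w, linear (fun v => YM v j w).
Hypothesis YM_linearr : forall v j, linear (YM v j).
Hypothesis YM_trunc :
  forall v w, exists N : int, forall j, N <= j -> YM v j w = 0.

Local Notation Y := (fcoef p YM).
Local Notation wc := (weak_commutativity p YM).
Local Notation assoc := (assoc_at p omega nu YM).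

Hypothesis wc_exists : forall u v, exists k, wc u v k.

Lemma assoc_mode w u n :
  (forall v s, exists t, assoc s w v t) -> (forall v s, exists t, assoc s u v t) ->
  forall v s, exists t, assoc s (vmode X w n u) v t.
Proof.
move=> Hw Hu v s; set ws := aut_pow nu (- s) w; set us := aut_pow nu (- s) u.
have [k1 wu] := wc_exists w u; have [k2 wv] := wc_exists w v.
have [k3 uv] := wc_exists u v.
have [k4 wu'] := weak_commutativity_voa_exists X ws us.
have [k5 wv'] := weak_commutativity_voa_exists X ws v.
have [k6 uv'] := weak_commutativity_voa_exists X us v.
(* The power y^i carries w_(k-1-i) u; the last summand makes the index [I] of w_n u nonnegative. The
   bounds t1 and t2 depend on k, hence the separate exponent g. *)
pose k := (k1 + k2 + k3 + k4 + k5 + k6 + `|n|.+1)%N.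
pose I := absz (k%:Z - 1 - n)%R.
have IE : I%:Z = k%:Z - 1 - n by rewrite /I /k; lia.
have [t1 Ht1] := weak_commutativity_uniform X p_gt0 YM_linearl YM_linearr w u v k I wc_exists.
have [t2 Ht2] := weak_commutativity_uniform X (ltn0Sn 0) (mode_linearl X) (mode_linearr X)
  ws us v k I (weak_commutativity_voa_exists X).
pose g := (k + t1 + t2)%N.
have up a b l k' (wab : wc a b l) : (l <= k')%N -> wc a b k'.
  by move=> lk; apply: weak_commutativity_up wab.
have upV a b l k' (wab : weak_commutativity 1 (vmode X) a b l) :
    (l <= k')%N -> weak_commutativity 1 (vmode X) a b k'.
  by move=> lk; apply: weak_commutativity_up wab.
have {}wu : wc w u k by apply: up wu _; rewrite /k; lia.
have {}wv : wc w v k by apply: up wv _; rewrite /k; lia.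
have {}uv : wc u v k by apply: up uv _; rewrite /k; lia.
have {}wu' : weak_commutativity 1 (vmode X) ws us k.
  by apply: upV wu' _; rewrite /k; lia.
have {}wv' : weak_commutativity 1 (vmode X) ws v k.
  by apply: upV wv' _; rewrite /k; lia.
have {}uv' : weak_commutativity 1 (vmode X) us v k.
  by apply: upV uv' _; rewrite /k; lia.
have kg : (k <= g)%N by rewrite /g; lia.
have uvg := up _ _ _ g uv kg; have uvg' := upV _ _ _ g uv' kg.
have Ht1g (j' : int) : j' <= I%:Z -> wc (vmode X w (k%:Z - 1 - j') u) v g.
  by move=> /Ht1 H; apply: up H _; rewrite /g; lia.
have Ht2g (j' : int) : j' <= I%:Z ->
    weak_commutativity 1 (vmode X) (vmode X ws (k%:Z - 1 - j') us) v g.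
  by move=> /Ht2 H; apply: upV H _; rewrite /g; lia.
have [[k' a0wu] [k'' asuv]] := (Hw u 0, Hu v s).
have {}a0wu := assoc_at_comm p_gt0 omega_p YM_linearr YM_trunc a0wu wu.
have {}asuv := assoc_at_comm p_gt0 omega_p YM_linearr YM_trunc asuv uvg.
exists g => z.
have fin (i' : int) : i' <= I%:Z ->
    fin_diag (iter g (dif p) (ser2 p YM (vmode X w (k%:Z - 1 - i') u) v z)).
  by move=> /Ht1g; apply: ser2_dif_fin.
have nE : k%:Z - 1 - I%:Z = n by lia.
split=> [|i c]; first by rewrite -nE; apply: fin.
pose L (i j : int) := limit_coef p omega s
  (iter g (dif p) (ser2 p YM (vmode X w (k%:Z - 1 - i) u) v z)) j c.
pose A (i j : int) := vmode X (vmode X ws (k%:Z - 1 - i) us) (g%:Z - 1 - j) v.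
(* The same formula on V itself identifies theta. *)
have thetaE (i' j : nat) : i'%:Z <= I%:Z ->
    iter k (opF 1) A i' j = theta X k g i' j ws us v.
  move=> iI.
  have H := @theta_formula K V X V 1 1 (voa_id X) (vmode X) isT (expr1n _ _)
    (mode_linearl X) (mode_linearr X) (vmode_trunc X) ws us v 0 k g i' j (vac X) 0
    wu' wv' uv' kg (voa_assoc 0 wu') (voa_assoc 0 uvg').
  (* Evaluating on the vacuum at the power 0 recovers a vector from its vertex operator. *)
  have cre x : fcoef 1 (vmode X) x 0 (vac X) = x.
    by rewrite fcoefE; have [] := creation X x.
  rewrite !aut_pow_id cre in H; rewrite -H.
  - apply: opF_eq_on (lexx i'%:Z) => i1 j1 i1I.
    have [_ ->] := voa_assoc 0 (Ht2g _ (le_trans i1I iI)) (vac X).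
    by rewrite cre aut_pow_id.
  - move=> J; apply: assoc_uniform => // [||x].
    + exact: mode_linearl.
    + exact: mode_linearr.
    have [t Ht] := weak_commutativity_voa_exists X ws x.
    by exists t; apply: voa_assoc.
  move=> i1 i1I; apply: (ser2_dif_fin (vmode_trunc X) (mode_linearr X)).
  by apply: Ht2g; apply: le_trans iI.
have LE (i' j : nat) : i'%:Z <= I%:Z ->
    iter k (opF 1) L i' j = Y (theta X k g i' j ws us v) c z.
  move=> iI; apply: (theta_formula p_gt0 omega_p) => //.
    by move=> J; apply: assoc_uniform => // x; apply: Hw.
  by move=> i1 i1I; apply: fin; apply: le_trans iI.
have Ylin : linear (fun x => Y x c z) by exact: YM_linearl.
(* Since k is also an exponent of associativity for [w] and [u] at s = 0, these operators are
   coefficients of negative powers in a limit. *)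
have Llow i' j : i' < 0 -> L i' j = 0.
  case: i' => // i' _.
  have P0 b x : Y (vmode X w (k%:Z - 1 - Negz i') u) b x = 0.
    by have [_ <-] := a0wu x; rewrite limit_neg.
  transitivity (limit_coef p omega s (fun _ _ => 0 : M) j c); last exact: limit0.
  by apply: eq_limit => a b; apply: iter_dif0 => ? ?; apply: P0.
have Alow (i' j : int) : i' < 0 -> A i' j = 0.
  move=> i0; rewrite /A (weak_commutativity_voa_mode wu') ?mode0 //; lia.
have Alow' (i' j : int) : i' <= I%:Z -> j < 0 -> A i' j = 0.
  by move=> iI j0; apply: (weak_commutativity_voa_mode (Ht2g _ iI)); lia.
(* For nonnegative powers, (x0 + y)^k times either term is Y of theta; for negative ones both terms
   vanish. Cancelling the factor gives [D] = 0 up to [I]. *)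
pose D (i' j : int) := L i' j - Y (A i' j) c z.
have D0 : forall i' j, i' <= I%:Z -> D i' j = 0.
  apply: (@opF_vanish _ _ k) => [i' j i0|i' j i0 iI].
    by rewrite /D Llow // Alow // (lin0 Ylin) subr0.
  have [j0|j0] := ltP j 0.
    apply: (iter_opF_low k 1 (I := I%:Z)) => // i1 j1 i1I j10.
    by rewrite /D Alow' // (lin0 Ylin) subr0; case: j1 j10.
  case: i' i0 iI => // i' _ iI; case: j j0 => // j _.
  by rewrite iter_opFB (iter_opF_lin k 1 A i' j Ylin) LE // thetaE // subrr.
have := D0 I%:Z i (lexx _); rewrite /D /L /A nE => /eqP.
by rewrite subr_eq0 => /eqP ->; rewrite aut_pow_mode.
Qed.

End AssociativityOfModes.

(* YM v j is the mode v_(j/p). The same vector can be written u_(n0-m) v in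
   several ways (for instance 0 = vac_(-1-m) vac for all m > 0), so no single
   function k on V * V satisfies the formula as an equation; it is stated for
   every admissible choice of the integers k(w,u) and k(w,v). *)
Theorem theorem5p5 (R : realType) (V : lmodType R[i]) (X : voa V)
    (p : nat) (p_gt0 : (0 < p)%N)
    (omega : R[i]) (omega_prim : p.-primitive_root omega)
    (nu : voa_aut X) (nu_p : forall v : V, iter p (aut nu) v = v)
    (M : lmodType R[i]) (YM : V -> int -> M -> M)
    (YM_linearl : forall (j : int) (w : M), linear (fun v => YM v j w))
    (YM_linearr : forall (v : V) (j : int), linear (YM v j))
    (YM_trunc : forall (v : V) (w : M),
       exists N : int, forall j : int, N <= j -> YM v j w = 0)
    (U : set V) (U_gen : generating X U)
    (U_comm : forall u v : V, U u -> U v ->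
       exists k : nat, weak_commutativity p YM u v k)
    (U_assoc : forall u v : V, U u ->
       exists k' : nat, modified_weak_associativity p omega nu YM u v k') :
  [/\ forall u v : V,
        (exists k : nat, weak_commutativity p YM u v k) /\
        (exists k' : nat, modified_weak_associativity p omega nu YM u v k'),
      forall (u v : V) (k : nat), weak_commutativity p YM u v k ->
        modified_weak_associativity p omega nu YM u v k,
      exists k : V -> V -> nat,
        (forall u v : V, U u -> U v -> lowest_comm_exponent X p YM u v (k u v)) /\
        (forall u v : V, common_exponent p omega nu YM u v (k u v)) &
      forall (u v w : V) (n0 : int) (m kwu kwv : nat),
        highest_mode X u v n0 ->
        common_exponent p omega nu YM w u kwu ->
        common_exponent p omega nu YM w v kwv ->
        common_exponent p omega nu YM (vmode X u (n0 - m%:Z) v) w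
          (kwu + kwv + m)%N].
Proof.
have op : omega ^+ p = 1 by apply: prim_expr_order.
have assocP := modified_weak_associativityP nu YM p_gt0 op.
have Uas s u v : U u -> exists k, assoc_at p omega nu YM s u v k.
  by move=> Uu; have [k /assocP H] := U_assoc u v Uu; exists k; apply: H.
have span := mode_span_full U_gen.
(* The span argument runs twice: with a letter fixed, then, by symmetry, with an arbitrary vector
   fixed. *)
have wcU u v : U u -> exists k, weak_commutativity p YM u v k.
  move=> Uu; apply: (weak_commutativity_span p_gt0 op YM_linearl YM_linearr
    (Uas 0) _ (span v)) => u' Uu'; exact: U_comm.
have wc u v : exists k, weak_commutativity p YM u v k.
  apply: (weak_commutativity_span p_gt0 op YM_linearl YM_linearr
    (Uas 0) _ (span v)) => u' Uu'.
  by have [k H] := wcU u' u Uu'; exists k; apply: weak_commutativity_sym.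
have assoc u : forall v s, exists k, assoc_at p omega nu YM s u v k.
  elim: {u}(span u) => [u Uu|u n u' Uu _ IH|v s|c u u' _ IH _ IH' v s].
  - by move=> v s; apply: Uas.
  - by apply: assoc_mode => // v s; apply: Uas.
  - by exists 0%N; apply: assoc_at_zero => //; left.
  have [[k H] [k' H']] := (IH v s, IH' v s).
  exists (k + k')%N; apply: assoc_at_lin => //.
    by apply: assoc_at_up H => //; apply: leq_addr.
  by apply: assoc_at_up H' => //; apply: leq_addl.
(* The exponents found so far may vary with s; the exponent of weak commutativity serves every s. *)
have wc_assoc u v k : weak_commutativity p YM u v k ->
    modified_weak_associativity p omega nu YM u v k.
  by move=> uv; apply/assocP => s; have [k' H] := assoc u v s; apply: assoc_at_comm H uv.
have wcV := weak_commutativity_voa_exists X.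
split=> //.
- move=> u v; have [k H] := wc u v; split; exists k => //; exact: wc_assoc.
- have ex u v : exists n, `[< comm_exponent X p YM u v n >].
    have [[k H] [k' H']] := (wc u v, wcV u v); exists (k + k')%N; apply/asboolP.
    by split; [apply: weak_commutativity_up H|apply: weak_commutativity_up H'];
      rewrite ?leq_addr ?leq_addl.
  exists (fun u v => ex_minn (ex u v)); split=> u v => [_ _|];
    case: ex_minnP => k /asboolP kP kmin; split=> //.
    by move=> n nP; apply: kmin; apply/asboolP.
  by apply: wc_assoc; case: kP.
move=> u v w n0 m kwu kwv [_ n0P] [[wu wu'] _] [[wv wv'] _].
have [k' uv] := assoc u v 0.
have H : weak_commutativity p YM (vmode X u (n0 - m%:Z) v) w (kwu + kwv + m).
  apply: weak_commutativity_sym; exact: (weak_commutativity_mode _ _ _ _ _ uv).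
split; last exact: wc_assoc.
by split=> //; apply: weak_commutativity_sym; apply: weak_commutativity_voa_comp.
Qed.
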